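(* Let $k,\ell\ge1$, $\lambda\in\mathrm{Par}^k_\ell$, $\Phi=\Delta^k(\lambda)$, and let $d\ge0$ and $m\in[\ell]$ be integers. Then $$\sum_{S\subset[m],\,|S|=d}H(\Phi;\lambda-\epsilon_S)=\sum_{T\in\mathrm{VSMT}^k_{(d)}(\lambda),\ \mathrm{marks}(T)\subset[m]}t^{\mathrm{spin}(T)}\,\mathfrak s^{(k)}_{\mathrm{inside}(T)},$$ $$\sum_{S\subset[\ell],\,|S|=d,\,\max(S)=m}H(\Phi;\lambda-\epsilon_S)=\sum_{T\in\mathrm{VSMT}^k_{(d)}(\lambda),\ \max(\mathrm{marks}(T))=m}t^{\mathrm{spin}(T)}\,\mathfrak s^{(k)}_{\mathrm{inside}(T)}.$$
   Context: $[a,b]=\{i\in\mathbb Z:a\le i\le b\}$, $[n]=[1,n]$; $\epsilon_i\in\mathbb Z^\ell$ standard basis vectors, $\epsilon_S=\sum_{i\in S}\epsilon_i$. For $\gamma\in\mathbb Z^\ell$, $s_\gamma=\det(h_{\gamma_i+j-i})_{1\le i,j\le\ell}$. $\Delta^+_\ell=\{(i,j):1\le i<j\le\ell\}$. For $\Psi\subset\Delta^+_\ell$ and $\gamma\in\mathbb Z^\ell$, $H(\Psi;\gamma)$ is obtained by expanding $\prod_{(i,j)\in\Psi}(1-tz_i/z_j)^{-1}z^\gamma$ as a power series in $t$ and applying coefficientwise the linear map $z^\beta\mapsto s_\beta$. $\mathrm{Par}^k_\ell=\{\mu\in\mathbb Z^\ell:k\ge\mu_1\ge\dots\ge\mu_\ell\ge0\}$,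 $\mathrm{Par}^k$ the partitions with largest part $\le k$ (identified with their zero-paddings). $\Delta^k(\mu)=\{(i,j)\in\Delta^+_\ell:k-\mu_i+i<j\}$ and $\mathfrak s^{(k)}_\mu=H(\Delta^k(\mu);\mu)$. Hook length of a box (English notation): boxes below it in its column plus those weakly to its right in its row. A $(k+1)$-core is a partition with no box of hook length $k+1$; $\mathfrak p(\kappa)$ has $r$-th part the number of boxes in row $r$ of $\kappa$ with hook length $\le k$ (a bijection from $(k+1)$-cores to $\mathrm{Par}^k$). A strong cover $\tau\Rightarrow\kappa$: $(k+1)$-cores, $\tau\subset\kappa$, $|\mathfrak p(\tau)|+1=|\mathfrak p(\kappa)|$; a strong marked cover $\tau\xRightarrow{r}\kappa$ adds a positive integer $r$ equal to the smallest row index of some connected component of $\kappa/\tau$; its spin is $c(h-1)+N$ with $c$ the number of components of $\kappa/\tau$, $h$ the common height of each component, $N$ the number of components entirely in rows $>r$. A vertical strong marked tableau of weight $(d)$ is a chain $T=(\kappa^{(0)}\xRightarrow{r_1}\cdots\xRightarrow{r_d}\kappa^{(d)})$ of strong marked covers with $r_1<r_2<\dots<r_d$; $\mathrm{spin}(T)$ is the sum of spins, $\mathrm{inside}(T)=\mathfrak p(\kappa^{(0)})$, $\mathrm{marks}(T)=\{r_1,\dots,r_d\}$; $\mathrm{VSMT}^k_{(d)}(\lambda)$ is the set of these with $\mathfrak p(\kappa^{(d)})=\lambda$. *)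

(* Defs.v *)
From HB Require Import structures.
From mathcomp Require Import all_boot all_order all_algebra.
From mathcomp Require Import finmap.
From mathcomp Require Import boolp classical_sets functions cardinality fsbigop.
From mathcomp Require Import monalg.

Set Implicit Arguments.
Unset Strict Implicit.
Unset Printing Implicit Defensive.

Import Order.TTheory GRing.Theory Num.Theory.

Local Open Scope ring_scope.

(* The ring of symmetric functions, as the polynomial ring Z[h_1, h_2, ...]:
   the variable of index n stands for h_(n+1). *)
Notation symf := {malg int[{cmonom nat}]}.

Definition hsym (z : int) : symf :=
  match z with
  | Posz 0 => 1
  | Posz n.+1 => << ucm n >>
  | Negz _ => 0
  end.

(* Power series in t over [symf]: [f n] is the coefficient of t^n. Only its
   pointwise additive structure is inherited from the function type. *)
Definition tseries := nat -> symf.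
HB.instance Definition _ := GRing.Zmodule.on tseries.

Definition tshift (s : nat) (f : tseries) : tseries :=
  fun n => if (s <= n)%N then f (n - s)%N else 0.

(* Indices are 0-based: i : 'I_l stands for the index i + 1 of the usual
   notation; differences of indices are unaffected. *)
Notation zvec l := {ffun 'I_l -> int}.

Definition eps l (i : 'I_l) : zvec l := [ffun j => (j == i)%:R].
Definition epsS l (S : {set 'I_l}) : zvec l := \sum_(i in S) eps i.

Definition sfun l (g : zvec l) : symf :=
  \det (\matrix_(i < l, j < l) hsym (g i + (j : nat)%:Z - (i : nat)%:Z)).

Definition posroots l : {set 'I_l * 'I_l} := [set p : 'I_l * 'I_l | (p.1 < p.2)%N].

(* A choice of one term (t z_i / z_j)^(f (i, j)) in each geometric series
   (1 - t z_i / z_j)^-1, (i, j) in Psi, of total degree n in t. *)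
Definition geometric_choice l (Psi : {set 'I_l * 'I_l}) (n : nat)
    (f : {ffun 'I_l * 'I_l -> 'I_n.+1}) : bool :=
  [forall p, (p \notin Psi) ==> (f p == ord0)] && (\sum_p f p == n)%N.

Definition catalanH l (Psi : {set 'I_l * 'I_l}) (g : zvec l) : tseries :=
  fun n => \sum_(f : {ffun 'I_l * 'I_l -> 'I_n.+1} | geometric_choice Psi f)
    sfun (g + \sum_(p in Psi) (eps p.1 - eps p.2) *+ f p).

Definition Par (k l : nat) (mu : zvec l) : Prop :=
  (forall i, 0 <= mu i <= k%:Z) /\
  (forall i j : 'I_l, (i <= j)%N -> mu j <= mu i).

Definition Deltak (k l : nat) (mu : zvec l) : {set 'I_l * 'I_l} :=
  [set p : 'I_l * 'I_l | (p \in posroots l) &&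
     (k%:Z - mu p.1 + (p.1 : nat)%:Z < (p.2 : nat)%:Z)].

Definition kschur (k l : nat) (mu : zvec l) : tseries :=
  catalanH (Deltak k mu) mu.

Definition is_partition (s : seq nat) : bool := sorted geq s && (0%N \notin s).

(* The box in (0-based) row r and column c. *)
Definition hook (s : seq nat) (r c : nat) : nat :=
  (count (fun p => c < p) (drop r.+1 s) + (nth 0 s r - c))%N.

Definition is_core (k : nat) (s : seq nat) : bool :=
  is_partition s &&
  all (fun r => all (fun c => hook s r c != k.+1) (iota 0 (nth 0 s r))%N)
      (iota 0 (size s)).

Definition pmap_core (k : nat) (s : seq nat) : seq nat :=
  [seq count (fun c => hook s r c <= k)%N (iota 0 (nth 0 s r))%N
     | r <- iota 0 (size s)].

(* The vector of length l of a partition with at most l nonzero parts. *)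
Definition pad (l : nat) (s : seq nat) : zvec l :=
  [ffun i : 'I_l => (nth 0 s i)%N%:Z].

(* Equality up to trailing zeros. *)
Definition same_partition l (s : seq nat) (mu : zvec l) : bool :=
  all (pred1 0%N) (drop l s) && (pad l s == mu).

Section Skew.
Variables (tau kappa : seq nat).

Definition contained : bool :=
  [forall r : 'I_(maxn (size tau) (size kappa)),
     (nth 0 tau r <= nth 0 kappa r)%N].

(* A finite type containing all boxes of [kappa]. *)
Definition box := ('I_(size kappa) * 'I_(head 0%N kappa))%type.

(* Row indices of boxes are 1-based, as the markings are positive. *)
Definition row_of (x : box) : nat := x.1.+1.

Definition skew : {set box} :=
  [set x : box | (nth 0 tau x.1 <= x.2 < nth 0 kappa x.1)%N].

Definition edge_adjacent (x y : box) : bool :=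
  [|| (x.1 == y.1) && ((x.2.+1 == y.2 :> nat) || (y.2.+1 == x.2 :> nat))
    | (x.2 == y.2) && ((x.1.+1 == y.1 :> nat) || (y.1.+1 == x.1 :> nat))].

Definition skew_edge : rel box :=
  fun x y => [&& x \in skew, y \in skew & edge_adjacent x y].

Definition components : {set {set box}} :=
  [set [set y | connect skew_edge x y] | x in skew].

Definition top_row (C : {set box}) (r : nat) : bool :=
  [exists x in C, row_of x == r] && [forall x in C, (r <= row_of x)%N].

Definition height (C : {set box}) : nat := #|[set x.1 | x : box in C]|.

(* All components of a strong cover have the same height; the maximum picks
   this common value. *)
Definition common_height : nat := \max_(C in components) height C.

Definition is_mark (r : nat) : bool := [exists C in components, top_row C r].

Definition spin_cover (r : nat) : nat :=
  (#|components| * (common_height - 1) +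
   #|[set C in components | [forall x in C, (r < row_of x)%N]]|)%N.

Definition strong_cover (k : nat) : bool :=
  [&& is_core k tau, is_core k kappa, contained &
      ((sumn (pmap_core k tau)).+1 == sumn (pmap_core k kappa))%N].

End Skew.

Definition strong_marked_cover (k : nat) (tau : seq nat) (r : nat)
    (kappa : seq nat) : bool :=
  strong_cover tau kappa k && is_mark tau kappa r.

(* The chain kappa^(0), ..., kappa^(d) and the marks r_1, ..., r_d. *)
Notation chain d := ((d.+1).-tuple (seq nat) * d.-tuple nat)%type.

Definition shape d (T : chain d) (i : nat) : seq nat := nth [::] T.1 i.
Definition marks d (T : chain d) : seq nat := T.2.

Definition spin d (T : chain d) : nat :=
  (\sum_(i < d) spin_cover (shape T i) (shape T i.+1) (nth 0 (marks T) i))%N.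

Definition inside (k d : nat) (T : chain d) : seq nat :=
  pmap_core k (shape T 0).

Definition VSMT (k d l : nat) (lam : zvec l) : set (chain d) :=
  [set T : chain d | [/\ (forall i, (i <= d)%N -> is_core k (shape T i)),
     (forall i, (i < d)%N ->
        strong_marked_cover k (shape T i) (nth 0 (marks T) i)%N (shape T i.+1)),
     sorted ltn (marks T)
   & same_partition (pmap_core k (shape T d)) lam]]%classic.
Arguments VSMT k d {l} lam.

(* Main.v *)
(* Let [E z] be the Catalan function of the k-Schur root ideal of [lam] with the weight
   lowered in row [z]. Then [E z = W z + t * E (D z)], where [(z, D z)] is the removable
   root of row [z] and [W z] is the contribution with that root deleted. Mirror
   straightening along the bounce path [y, D y, ..., D^q y = z] shows that [W z] is
   either zero or [t ^ ((q + 1) (h - 1))] times the k-Schur function of the core obtained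
   from the core of [lam] by removing one ribbon of height [h] starting in each row of
   the path, and these smaller cores are exactly the strong covers. Hence [E m] is the
   sum over the strong covers marked in row [m], the exponents of [t] adding up to the
   spin. The cancellations used are compatible with lowering, in addition, a set of rows
   [< m] in all possible ways, and the theorem follows by induction on [d], peeling off
   the largest mark. *)

Require Import Defs.
From HB Require Import structures.
From mathcomp Require Import all_boot all_order all_algebra.
From mathcomp Require Import fingroup perm.
From mathcomp Require Import boolp classical_sets functions cardinality fsbigop.
From mathcomp Require Import monalg zify ring.

Set Implicit Arguments.
Unset Strict Implicit.
Unset Printing Implicit Defensive.

Import Order.TTheory GRing.Theory Num.Theory.

Local Open Scope ring_scope.

(** * Recurrence and symmetry of Catalan functions *)

(** Two readings of one map link both sides. The first root of row [i] in the root ideal of lambda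
    lies in column [row_start k lam i]; in the core of lambda, the row with that index is the one
    whose bead lies [k + 1] places below the bead of row [i]. So the bounce path follows a runner of
    the abacus, and the rows of a core satisfy [row s i = mu i + row s (D i)], from which the
    smaller core can be computed row by row. Straightening needs antisymmetry under adjacent swaps,
    which a single subset [S] destroys. That no strong cover is missed is a statement about beads
    alone: every core properly contained in the given one is contained in one of the smaller cores
    constructed here, and each of these has a bounded partition of size exactly one less. *)

Section Recurrence.
Variable l : nat.
Implicit Types (Psi : {set 'I_l * 'I_l}) (g : zvec l).

(* As [geometric_choice], with a bound [M] on the exponents independent of the
   degree [n], so that different degrees can be compared. *)
Definition bounded_choice Psi M n (f : {ffun 'I_l * 'I_l -> 'I_M.+1}) : bool :=
  [forall p, (p \notin Psi) ==> (f p == ord0)] && (\sum_p f p == n)%N.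

Definition raising Psi M (f : {ffun 'I_l * 'I_l -> 'I_M.+1}) : zvec l :=
  \sum_(p in Psi) (eps p.1 - eps p.2) *+ f p.

Lemma le_sum_ffun M n (f : {ffun 'I_l * 'I_l -> 'I_M.+1}) p :
  (\sum_p f p = n)%N -> (f p <= n)%N.
Proof. by move=> <-; rewrite (bigD1 p) //= leq_addr. Qed.

Lemma bounded_choiceP Psi M n (f : {ffun 'I_l * 'I_l -> 'I_M.+1}) :
  reflect ((forall p, p \notin Psi -> f p = 0 :> nat) /\ (\sum_p f p = n)%N)
          (bounded_choice Psi n f).
Proof.
apply: (iffP andP) => [[/forallP fP /eqP fn]|[fP fn]]; split=> //.
- by move=> p pP; move: (fP p); rewrite pP => /eqP ->.
- by apply/forallP=> p; apply/implyP=> /fP fp; apply/eqP/val_inj.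
- exact/eqP.
Qed.

Lemma catalanH_bounded Psi M n g : (n <= M)%N ->
  catalanH Psi g n =
  \sum_(f : {ffun 'I_l * 'I_l -> 'I_M.+1} | bounded_choice Psi n f)
    sfun (g + raising Psi f).
Proof.
move=> leM; rewrite [RHS](reindex_onto
  (fun f : {ffun 'I_l * 'I_l -> 'I_n.+1} => [ffun p => inord (f p)])
  (fun f => [ffun p => inord (f p)])) /=; last first.
  move=> f /bounded_choiceP[_ fn]; apply/ffunP=> p; rewrite !ffunE.
  have fp := le_sum_ffun p fn.
  by apply: val_inj; rewrite /= inordK inordK // ltnS.
have K (f0 : {ffun 'I_l * 'I_l -> 'I_n.+1}) p :
    ([ffun p0 => inord (f0 p0)] : {ffun _ -> 'I_M.+1}) p = f0 p :> nat.
  by rewrite ffunE inordK // (leq_trans (ltn_ord _)).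
apply: eq_big => [f|f _]; last first.
  by rewrite /raising; congr (sfun (_ + _)); apply: eq_bigr => p _; rewrite K.
have -> : [ffun p => inord (([ffun p0 => inord (f p0)] : {ffun _ -> 'I_M.+1}) p)]
    == f.
  by apply/eqP/ffunP=> p; apply: val_inj; rewrite ffunE K inord_val.
rewrite andbT; congr (_ && _).
  by apply: eq_forallb => p; congr (_ ==> _); rewrite -!val_eqE /= K.
by congr (_ == _); apply: eq_bigr => p _; rewrite K.
Qed.

(** This is 1/(1 - x) = 1 + x/(1 - x) for the factor of [b]: the choices with exponent 0 at [b] give
    the first term, and lowering a positive exponent at [b] by one gives the second. *)
Lemma catalanH_recurrence Psi (b : 'I_l * 'I_l) g : b \in Psi ->
  catalanH Psi g = catalanH (Psi :\ b) g
                   + tshift 1 (catalanH Psi (g + eps b.1 - eps b.2)).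
Proof.
move=> bP; apply: functional_extensionality_dep => n.
have -> (f f' : tseries) : (f + f') n = f n + f' n by [].
rewrite [LHS]/catalanH (bigID (fun f : {ffun _ -> 'I_n.+1} => f b == ord0)).
apply: (f_equal2 +%R).
  rewrite /catalanH; apply: eq_big => [f|f /andP[_ /eqP fb]].
    rewrite /geometric_choice andbAC; congr (_ && _).
    apply/andP/forallP => [[/forallP fP fb] p|fP].
      by rewrite !inE negb_and negbK; case: eqP => [->|_] //=.
    split; last by move: (fP b); rewrite !inE eqxx.
    apply/forallP => p; apply/implyP => pP; move: (fP p).
    by rewrite !inE (negbTE pP) andbF.
  congr (sfun (_ + _)); rewrite (bigD1 b) //= fb mulr0n add0r.
  by apply: eq_bigl => p; rewrite !inE andbC.
case: n => [|n].
  by rewrite big1 // => f /andP[_] /negP[]; rewrite ord1.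
rewrite [RHS](_ : _ = catalanH Psi (g + eps b.1 - eps b.2) n); last first.
  by rewrite /tshift subSS subn0.
rewrite (catalanH_bounded _ _ (leqnSn n)).
(* [inord] sends an exponent out of range to 0, so [down] inverts [up] only where [f b <= n]; a
   choice of total degree [n] satisfies this. *)
pose up (f : {ffun 'I_l * 'I_l -> 'I_n.+2}) : {ffun 'I_l * 'I_l -> 'I_n.+2} :=
  [ffun p => inord (f p + (p == b))%N].
pose down (f : {ffun 'I_l * 'I_l -> 'I_n.+2}) : {ffun 'I_l * 'I_l -> 'I_n.+2} :=
  [ffun p => inord (f p - (p == b))%N].
have downE f p : down f p = (f p - (p == b))%N :> nat.
  by rewrite ffunE inordK // (leq_ltn_trans (leq_subr _ _)).
have upE (f : {ffun 'I_l * 'I_l -> 'I_n.+2}) p : (\sum_p f p = n)%N ->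
  up f p = (f p + (p == b))%N :> nat.
  move=> fn; have fp := le_sum_ffun p fn.
  by rewrite ffunE inordK //; case: eqP; lia.
have sum_b : (\sum_p (p == b) = 1)%N.
  by move=> *; rewrite (bigD1 b) //= eqxx big1 // => i /negbTE ->.
rewrite [LHS](reindex_onto up down); last first.
  move=> f /andP[_ fb]; apply/ffunP=> p; apply: val_inj.
  rewrite ffunE downE subnK ?inord_val //; case: eqP => // ->.
  by rewrite lt0n.
have updown f : (down (up f) == f) = (f b <= n)%N.
  apply/eqP/idP => [<-|fb].
    by rewrite downE eqxx leq_subLR add1n -ltnS.
  apply/ffunP=> p; apply: val_inj; rewrite /= downE.
  rewrite ffunE inordK ?addnK //.
  by case: eqP => [->|_]; move: (ltn_ord (f p)) fb; lia.
have sumup (f : {ffun 'I_l * 'I_l -> 'I_n.+2}) : (f b <= n)%N ->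
    (\sum_p up f p = (\sum_p f p).+1)%N.
  move=> fb; transitivity (\sum_p f p + \sum_p (p == b))%N; last first.
    by rewrite sum_b addn1.
  rewrite -big_split; apply: eq_bigr => p _.
  rewrite ffunE inordK //; move: (ltn_ord (f p)) fb.
  by case: eqP => [->|_]; lia.
apply: eq_big => [f|f /andP[_]].
  rewrite updown; apply/idP/idP => [/andP[/andP[/andP[/forallP fP /eqP fn] _] fb]|].
    move: fn; rewrite sumup // => -[fn]; apply/bounded_choiceP; split=> // p pP.
    move: (fP p); rewrite pP -val_eqE /= upE //.
    by case: (p =P b) pP => [->|_ _ /eqP]; rewrite ?bP ?addn0.
  move=> /bounded_choiceP[fP fn].
  have fb := le_sum_ffun b fn.
  rewrite fb andbT; apply/andP; split; first apply/andP; first split.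
  - apply/forallP=> p; apply/implyP=> pP; rewrite -val_eqE /= upE // fP //.
    by case: (p =P b) pP => [->|//]; rewrite bP.
  - by rewrite sumup // fn.
  - by apply/eqP => fb0; move: (upE f b fn); rewrite fb0 eqxx addn1.
rewrite updown => fb; congr sfun; rewrite -addrA -addrA; congr (_ + _).
rewrite [RHS]addrA /raising (bigD1 b) //= [in RHS](bigD1 b) //= ffunE inordK;
  last first.
  by rewrite eqxx addn1 ltnS.
rewrite eqxx addn1 mulrS -!addrA; congr (_ + (_ + (_ + _))).
apply: eq_bigr => p /andP[_ /negbTE pb]; rewrite ffunE pb addn0.
by rewrite inord_val.
Qed.
End Recurrence.

Section Symmetries.
Variable l : nat.
Implicit Types (Psi : {set 'I_l * 'I_l}) (g : zvec l).

(** For [j = i + 1] this is the dot action: the entries [i] and [j] of [g + rho] are exchanged, rho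
    being the staircase. On the Jacobi-Trudi matrix it exchanges two rows. *)
Definition dot_swap (i j : 'I_l) g : zvec l :=
  [ffun x => g (tperm i j x) + (x == j)%:R - (x == i)%:R].

Lemma sfun_dot_swap (i j : 'I_l) g : j = i.+1 :> nat ->
  sfun (dot_swap i j g) = - sfun g.
Proof.
move=> ij; rewrite /sfun; set A := (X in \det X); set B := (X in - \det X).
have -> : A = row_perm (tperm i j) B.
  apply/matrixP=> x y; rewrite !mxE ffunE; congr hsym.
  have ji : (j == i) = false by apply/eqP => ji; move: ij; rewrite ji; lia.
  case: tpermP => [->|->|/eqP/negbTE xi /eqP/negbTE xj].
  - by rewrite eqxx eq_sym ji; lia.
  - by rewrite eqxx ji; lia.
  - by rewrite xi xj; lia.
rewrite row_permE det_mulmx det_perm odd_tperm.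
have -> : i != j by apply/eqP => ji; move: ij; rewrite ji; lia.
by rewrite expr1 mulN1r.
Qed.

Lemma catalanH_dot_swap Psi (i j : 'I_l) g : j = i.+1 :> nat ->
  (forall a b, ((tperm i j a, tperm i j b) \in Psi) = ((a, b) \in Psi)) ->
  catalanH Psi (dot_swap i j g) = - catalanH Psi g.
Proof.
move=> ij PsiE; apply: functional_extensionality_dep => n.
have -> : (- catalanH Psi g) n = - (catalanH Psi g n) by [].
pose s (p : 'I_l * 'I_l) := (tperm i j p.1, tperm i j p.2).
have sK : involutive s by case=> a b; rewrite /s /= !tpermK.
have sP p : (s p \in Psi) = (p \in Psi) by case: p => a b; rewrite PsiE.
pose h (f : {ffun 'I_l * 'I_l -> 'I_n.+1}) : {ffun 'I_l * 'I_l -> 'I_n.+1} :=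
  [ffun p => f (s p)].
have hK : involutive h by move=> f; apply/ffunP => p; rewrite !ffunE sK.
rewrite /catalanH [LHS](reindex_inj (inv_inj hK)).
rewrite -[RHS]sumrN.
apply: eq_big => [f|f _].
  congr (_ && _).
    apply/forallP/forallP => fP p; move: (fP (s p)); rewrite sP ffunE ?sK //.
  congr (_ == _); rewrite [RHS](reindex_inj (inv_inj sK)).
  by apply: eq_bigr => p _; rewrite ffunE.
rewrite -(sfun_dot_swap _ ij); congr sfun; apply/ffunP=> x.
rewrite [dot_swap i j (_ + _) x]ffunE [X in _ = X + _ - _]ffunE.
rewrite [LHS]ffunE [X in X + _]ffunE.
rewrite [X in _ + X = _](_ : _ =
    (\sum_(p in Psi) (eps p.1 - eps p.2) *+ f p) (tperm i j x)); first by ring.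
rewrite !sum_ffunE (reindex_inj (inv_inj sK)) /=.
apply: eq_big => [p|p _]; first by rewrite sP.
have xE (a : 'I_l) : (x == tperm i j a) = (tperm i j x == a).
  by rewrite (can2_eq (tpermK i j) (tpermK i j)).
have -> : h f (s p) = f p by rewrite ffunE sK.
rewrite !ffunMnE; congr (_ *+ _).
by rewrite /= !ffunE !xE.
Qed.

Lemma tseries_eqN0 (f : tseries) : f = - f -> f = 0.
Proof.
move=> fE; apply: functional_extensionality_dep => n.
have : f n = - f n by rewrite {1}fE.
move: (f n) => x xE; apply/malgP => m; have := congr1 (mcoeff m) xE.
by rewrite mcoeffN mcoeff0; lia.
Qed.

(* [sum_(z <= i) (s i - z) <= sum_i (s i - z)], which does not depend on [s];
   the truncated subtraction discards the terms [i < z]. *)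
Lemma sum_perm_tail (s : 'S_l) (z : nat) :
  (\sum_(i < l | z <= i) (s i - z) <= \sum_(i < l | z <= i) (i - z))%N.
Proof.
rewrite [leqRHS](_ : _ = \sum_(i < l) (s i - z))%N; last first.
  rewrite [RHS](reindex_inj (h := (s^-1)%g)); last exact: perm_inj.
  rewrite [LHS]big_mkcond; apply: eq_bigr => i _; rewrite permKV.
  by case: leqP => //; lia.
by rewrite [leqRHS](bigID (fun i : 'I_l => z <= i)%N) /= leq_addr.
Qed.

(** In each term of the determinant the indices of the factors from the rows [i >= z] have negative
    sum, because a permutation cannot raise the sum of the last positions. So one factor has a
    negative index. *)
Lemma sfun_vanish g (z : nat) : \sum_(i < l | (z <= i)%N) g i < 0 -> sfun g = 0.
Proof.
move=> gz; rewrite /sfun /determinant big1 // => s _.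
suff [i si] : exists i : 'I_l, g i + (s i : nat)%:Z - (i : nat)%:Z < 0.
  rewrite (bigD1 i) //= mxE; case: (_ - _) si => // n _.
  by rewrite mul0r mulr0.
apply/existsP; apply: contraTT gz => /existsPn gs; rewrite -leNgt.
have H : 0 <= \sum_(i < l | (z <= i)%N) (g i + (s i : nat)%:Z - (i : nat)%:Z).
  by apply: sumr_ge0 => i _; rewrite leNgt gs.
apply: (le_trans H).
rewrite -subr_ge0 -sumrB.
have := sum_perm_tail s z.
rewrite -(ler_nat int) !natr_sum -subr_ge0 -sumrB => H1.
apply: (le_trans H1); apply: ler_sum => i zi.
by rewrite !natz; lia.
Qed.

(** A positive root moves weight to an earlier row, so it never increases a tail sum. *)
Lemma catalanH_vanish Psi g (z : nat) : Psi \subset posroots l ->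
  \sum_(i < l | (z <= i)%N) g i < 0 -> catalanH Psi g = 0.
Proof.
move=> /fintype.subsetP PsiP gz; apply: functional_extensionality_dep => n.
rewrite /catalanH big1 // => f _; apply: (@sfun_vanish _ z).
under eq_bigr do rewrite ffunE sum_ffunE.
rewrite big_split /= exchange_big /=; apply: (le_lt_trans _ gz).
rewrite gerDl; apply: sumr_le0 => p /PsiP; rewrite inE => p12.
under eq_bigr do rewrite ffunMnE.
rewrite sumrMnl; apply: mulrn_wle0.
have eE (a : 'I_l) : \sum_(i < l | (z <= i)%N) eps a i = (z <= a)%:R.
  rewrite big_mkcond (bigD1 a) //= ffunE eqxx big1 ?addr0; first by case: ifP.
  by move=> i /negbTE ia; rewrite ffunE ia; case: ifP.
rewrite (eq_bigr (fun i => eps p.1 i - eps p.2 i)) => [|i _]; last first.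
  by rewrite !ffunE.
rewrite sumrB !eE.
case: (leqP z p.1) => zp1; last by rewrite sub0r oppr_le0 ler0n.
by rewrite (leq_trans zp1 (ltnW p12)) subrr.
Qed.
End Symmetries.

(** * Subset lowering of Catalan functions *)

Section Rows.
Variables l m d : nat.
Implicit Types (D : nat -> nat) (g : nat -> int) (S : {set 'I_l}).

Definition zvec_of g : zvec l := [ffun i : 'I_l => g i].

Definition row_roots D : {set 'I_l * 'I_l} :=
  [set p : 'I_l * 'I_l | (p.1 < p.2)%N && (D p.1 <= p.2)%N].

(* The image of the Catalan function under the lowering operator
   [e_d (z_1^-1, ..., z_m^-1)]. It satisfies the same recurrences as the Catalan
   function itself, except that rows [m - 1] and [m] must not be swapped. *)
Definition lowered D g : tseries :=
  \sum_(S : {set 'I_l} | [forall i in S, (i.+1 <= m)%N] && (#|S| == d))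
    catalanH (row_roots D) (zvec_of g - epsS S).

(* Deletes the root [(a, D a)]. *)
Definition bump_row D (a : nat) : nat -> nat := fun i => (D i + (i == a))%N.

Lemma lowered_ext D D' g g' :
  (forall i, (i < l)%N -> g i = g' i) ->
  (forall i j, (i < j < l)%N -> (D i <= j)%N = (D' i <= j)%N) ->
  lowered D g = lowered D' g'.
Proof.
move=> gE DE; apply: eq_bigr => S _; congr (catalanH _ (_ - _)).
  apply/setP => -[a b]; rewrite !inE /=; case ab: (a < b)%N => //=.
  by rewrite DE // ab ltn_ord.
by apply/ffunP=> i; rewrite !ffunE gE.
Qed.

Lemma tshiftD s (f f' : tseries) : tshift s (f + f') = tshift s f + tshift s f'.
Proof.
apply: functional_extensionality_dep => n.
have addE (x y : tseries) : (x + y) n = x n + y n by [].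
rewrite addE /tshift; case: ifP => // _; by rewrite addr0.
Qed.

Lemma tshift0 s : tshift s 0 = 0.
Proof. by apply: (addrI (tshift s 0)); rewrite -tshiftD !addr0. Qed.

Lemma tshiftN s (f : tseries) : tshift s (- f) = - tshift s f.
Proof. by apply: (addrI (tshift s f)); rewrite -tshiftD !subrr tshift0. Qed.

Lemma tshift_sum s (I : Type) (r : seq I) (P : pred I) (F : I -> tseries) :
  tshift s (\sum_(i <- r | P i) F i) = \sum_(i <- r | P i) tshift s (F i).
Proof. by apply: big_morph; [exact: tshiftD | exact: tshift0]. Qed.

Lemma tshift_tshift s s' (f : tseries) : tshift s (tshift s' f) = tshift (s + s') f.
Proof.
apply: functional_extensionality_dep => n; rewrite /tshift.
case: (leqP s n) => sn; last by rewrite leqNgt (leq_trans sn (leq_addr _ _)).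
by rewrite leq_subRL // subnDA.
Qed.

Lemma tshift_0 (f : tseries) : tshift 0 f = f.
Proof. by apply: functional_extensionality_dep => n; rewrite /tshift /= subn0. Qed.

Lemma lowered_recurrence D g a : (a < D a < l)%N ->
  lowered D g = lowered (bump_row D a) g
    + tshift 1 (lowered D (fun i => g i + (i == a)%:Z - (i == D a)%:Z)).
Proof.
move=> /andP[aD Dl]; rewrite tshift_sum -big_split; apply: eq_bigr => S _.
have al := ltn_trans aD Dl.
pose b : 'I_l * 'I_l := (Ordinal al, Ordinal Dl).
have bP : b \in row_roots D by rewrite inE /= aD leqnn.
rewrite [LHS](catalanH_recurrence _ bP).
apply: (f_equal2 +%R); last apply: (congr1 (tshift 1)).
  congr catalanH; apply/setP => -[x y]; rewrite !inE xpair_eqE -!val_eqE /=.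
  rewrite /bump_row; case: (x =P a :> nat) => [->|_] /=; last by rewrite addn0.
  by case: (y =P D a :> nat) => /=; lia.
congr catalanH; apply/ffunP => x; rewrite !ffunE -!val_eqE /= !natz.
by ring.
Qed.

Lemma epsSE S x : epsS S x = (x \in S)%:R.
Proof.
rewrite sum_ffunE; under eq_bigr do rewrite ffunE.
case xS: (x \in S); last first.
  rewrite big1 // => i iS; case: (x =P i) => // xi.
  by move: xS; rewrite xi iS.
rewrite (bigD1 x) //= eqxx big1 ?addr0 // => i /andP[_].
by rewrite eq_sym => /negbTE ->.
Qed.

(** Equal starts of rows [a], [a + 1] (a wall), no start in column [a + 1] (a ceiling) and the
    absence of the root [(a, a + 1)] make the root set invariant under the swap. The sets [S] are
    swapped as well; [a.+1 != m] keeps them inside the first [m] rows. *)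
Lemma lowered_swap D g g' a :
  (a.+1 < l)%N -> a.+1 != m -> D a = D a.+1 -> (a.+1 < D a)%N ->
  (forall c, D c != a.+1) ->
  g' a = g a.+1 - 1 -> g' a.+1 = g a + 1 ->
  (forall c, c != a -> c != a.+1 -> g' c = g c) ->
  lowered D g' = - lowered D g.
Proof.
move=> al am wall aD ceil ga ga1 gc.
pose i : 'I_l := Ordinal (ltnW al); pose j : 'I_l := Ordinal al.
pose s S := tperm i j @: S.
have sP S x : (x \in s S) = (tperm i j x \in S).
  by rewrite -{1}(tpermK i j x) (mem_imset _ _ perm_inj).
have sK : involutive s by move=> S; apply/setP => x; rewrite !sP tpermK.
rewrite /lowered -sumrN (reindex_inj (inv_inj sK)); apply: eq_big => [S|S _].
  rewrite card_imset; last exact: perm_inj.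
  congr (_ && _); apply/forall_inP/forall_inP => SP x.
    move=> xS; have := SP (tperm i j x).
    by rewrite sP tpermK => /(_ xS); case: tpermP => [->|->|//] /=; lia.
  by rewrite sP => /SP; case: tpermP => [->|->|//] /=; lia.
transitivity (catalanH (row_roots D) (dot_swap i j (zvec_of g - epsS S))).
  congr catalanH; apply/ffunP=> x; rewrite !ffunE !epsSE sP.
  rewrite -addrA [X in _ = X]addrAC -!addrA.
  suff -> : g' x = g (tperm i j x) + (x == j)%:R - (x == i)%:R by ring.
  case: tpermP => [->|->|/eqP xi /eqP xj].
  - by rewrite /= ga eqxx -val_eqE /=; case: eqP; lia.
  - by rewrite /= ga1 eqxx -val_eqE /=; case: eqP; lia.
  - by rewrite gc ?(negbTE xi) ?(negbTE xj) ?addr0 ?subr0.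
apply: catalanH_dot_swap => // x y; rewrite !inE /=.
move: (ceil x) (ceil y).
by case: (tpermP i j x) => [->|->|/eqP + /eqP +];
   case: (tpermP i j y) => [->|->|/eqP + /eqP +]; rewrite -?val_eqE /=; lia.
Qed.

(** The weight is fixed by the dot action, so the function is its own negative. *)
Lemma lowered_toggle D g a :
  (a.+1 < l)%N -> a.+1 != m -> D a = D a.+1 -> (a.+1 < D a)%N ->
  (forall c, D c != a.+1) -> g a.+1 = g a + 1 -> lowered D g = 0.
Proof.
move=> al am wall aD ceil ga; apply: tseries_eqN0.
by apply: (lowered_swap al am wall aD ceil) => //; rewrite ga ?addrK.
Qed.

Lemma lowered_vanish D g z :
  \sum_(i < l | (z <= i)%N) g i < 0 -> lowered D g = 0.
Proof.
move=> gz; rewrite /lowered big1 // => S _; apply: (@catalanH_vanish _ _ _ z).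
  by apply/fintype.subsetP => p; rewrite !inE => /andP[].
apply: le_lt_trans gz; apply: ler_sum => i _; rewrite ffunE [zvec_of _ _]ffunE.
by rewrite ffunE epsSE gerDl oppr_le0 ler0n.
Qed.
End Rows.

(** * Mirror straightening *)

Section Mirror.
Variables l m d : nat.
Implicit Types (D X : nat -> nat) (g : nat -> int).
Local Notation HX := (lowered l m d).

Lemma lowered_eq D D' g g' : D =1 D' -> g =1 g' -> HX D g = HX D' g'.
Proof. by move=> DE gE; apply: lowered_ext => [i _|i j _]; rewrite ?gE ?DE. Qed.

(** Adding the root [(x.+1, y)] turns such a pair of rows into a wall; by the last clause no row
    then starts in column [y.+1], so the columns [y], [y.+1] acquire a ceiling. *)
Definition mirror D (x y : nat) : Prop :=
  [/\ D x = y, D x.+1 = y.+1, (x.+1 < y)%N & forall c, D c = y.+1 -> c = x.+1].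

Lemma mirror_mono D X q : (forall j, (j < q)%N -> mirror D (X j) (X j.+1)) ->
  forall i j, (i <= j <= q)%N -> (X i <= X j)%N.
Proof.
move=> mir i j; elim: j => [|j IH]; first by rewrite leqn0 => /andP[/eqP ->].
case: (i =P j.+1) => [-> //|/eqP ij] ijq.
by have [_ _ + _] := mir j ltac:(lia); have := IH ltac:(lia); lia.
Qed.

(* Adding the root [(X 0 + 1, X 1)] to the root set turns the mirror in rows
   [X 0], [X 0 + 1] into a wall and moves the ceiling to columns
   [X 1], [X 1 + 1]; the correction term vanishes by [lowered_toggle]. *)
Lemma mirror_swap q D X g g' :
  (forall j, (j < q)%N -> mirror D (X j) (X j.+1)) ->
  (forall c, D c <> (X 0%N).+1) ->
  D (X q) = D (X q).+1 -> ((X q).+1 < D (X q))%N -> ((X q).+1 < l)%N ->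
  (forall j, (j <= q)%N -> (X j).+1 <> m) ->
  (forall j, (j < q)%N -> g (X j).+1 = g (X j)) ->
  g' (X q) = g (X q).+1 - 1 -> g' (X q).+1 = g (X q) + 1 ->
  (forall c, c != X q -> c != (X q).+1 -> g' c = g c) ->
  HX D g' = - HX D g.
Proof.
elim: q D X g g' => [|q IH] D X g g' mir ceil wall wl ql Xm gX gq gq1 gc.
  apply: (@lowered_swap _ _ _ _ _ _ (X 0%N)) => //; first by apply/eqP/Xm.
  by move=> c; apply/eqP.
have mono := mirror_mono mir.
set x := X 0%N; set y := X 1%N.
have [Dx Dx1 xy Dun] := mir 0%N isT; rewrite -/x -/y in Dx Dx1 xy Dun.
have yq : (y <= X q.+1)%N by exact: (mono 1%N q.+1 ltac:(lia)).
pose D' i := (D i - (i == x.+1))%N.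
have D'E c : c <> x.+1 -> D' c = D c by rewrite /D'; case: eqP => // _ _;
  rewrite subn0.
have D'x : D' x.+1 = y by rewrite /D' eqxx Dx1 subn1.
have red f : f x.+1 = f x -> HX D f = HX D' f.
  move=> fx; rewrite [RHS](@lowered_recurrence _ _ _ _ _ x.+1);
    last by rewrite D'x; lia.
  rewrite [X in tshift 1 X](@lowered_toggle _ _ _ _ _ x) ?tshift0 ?addr0.
  - apply: lowered_eq => // i; rewrite /bump_row.
    by case: (i =P x.+1) => [->|/D'E ->]; rewrite ?D'x ?Dx1 ?addn1 ?addn0.
  - lia.
  - by apply/eqP/(Xm 0%N).
  - by rewrite D'x D'E //; lia.
  - by rewrite D'E; lia.
  - move=> c; apply/eqP; case: (c =P x.+1) => [->|/D'E ->]; last exact: ceil.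
    by rewrite D'x; lia.
  - by rewrite fx D'x; lia.
have gx := gX 0%N isT.
rewrite !red //; last first.
  by rewrite !gc //; apply/eqP; rewrite -/x; lia.
apply: (IH D' (fun j => X j.+1)) => //.
- move=> j jq; have [H1 H2 H3 H4] := mir j.+1 jq.
  have yj : (y <= X j.+1)%N by exact: (mono 1%N j.+1 ltac:(lia)).
  split; rewrite ?D'E //; try lia.
  move=> c; case: (c =P x.+1) => [->|/D'E ->]; last exact: H4.
  by rewrite D'x; lia.
- move=> c; case: (c =P x.+1) => [->|cx]; rewrite ?D'x ?D'E //.
  by move/Dun.
- by rewrite !D'E //; lia.
- by rewrite D'E //; lia.
- by move=> j jq; apply: Xm.
- by move=> j jq; apply: gX.
Qed.

Lemma mirror_vanish q D X g :
  (forall j, (j < q)%N -> mirror D (X j) (X j.+1)) ->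
  (forall c, D c <> (X 0%N).+1) ->
  D (X q) = D (X q).+1 -> ((X q).+1 < D (X q))%N -> ((X q).+1 < l)%N ->
  (forall j, (j <= q)%N -> (X j).+1 <> m) ->
  (forall j, (j < q)%N -> g (X j).+1 = g (X j)) ->
  g (X q).+1 = g (X q) + 1 -> HX D g = 0.
Proof.
move=> mir ceil wall wl ql Xm gX gq; apply: tseries_eqN0.
by apply: (mirror_swap mir ceil wall wl ql Xm gX) => //; rewrite gq ?addrK.
Qed.

(** One step expands at the root [(X q, X q.+1)]. Raising it moves the lowering from [X q] to
    [X q.+1] at the cost of one [t]. Deleting it creates a wall in rows [X q], [X q + 1] with
    weights differing by one, and [mirror_vanish] applies. *)
Lemma mirror_transfer q D X g :
  (forall j, (j < q)%N -> mirror D (X j) (X j.+1)) ->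
  (forall c, D c <> (X 0%N).+1) -> (X q < l)%N ->
  (forall j, (j < q)%N -> (X j).+1 <> m) ->
  (forall j, (j < q)%N -> g (X j).+1 = g (X j)) ->
  HX D (fun i => g i - (i == X 0%N)%:Z) =
  tshift q (HX D (fun i => g i - (i == X q)%:Z)).
Proof.
elim: q => [|q IH] mir ceil ql Xm gX; first by rewrite tshift_0.
have mono := mirror_mono mir.
have [Dx Dx1 xy Dun] := mir q (ltnSn q).
have ql' : (X q < l)%N by lia.
apply: etrans (IH (fun j jq => mir j (ltnW jq)) ceil ql'
  (fun j jq => Xm j (ltnW jq)) (fun j jq => gX j (ltnW jq))) _.
rewrite -(addn1 q) -tshift_tshift; apply: (congr1 (tshift q)).
rewrite [LHS](@lowered_recurrence _ _ _ _ _ (X q)); last by rewrite Dx; lia.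
rewrite (@mirror_vanish q _ X) ?add0r.
- by apply: (congr1 (tshift 1)); apply: lowered_eq => // i; rewrite Dx addn1; lia.
- move=> j jq; have [H1 H2 H3 H4] := mir j (ltnW jq).
  have jq1 := mono j.+1 q ltac:(lia).
  rewrite /bump_row; split; try lia.
  move=> c; case: (c =P X q) => [->|_]; last by rewrite addn0 => /H4.
  by rewrite Dx; lia.
- move=> c; rewrite /bump_row; case: (c =P X q) => [->|_].
    by have := mono 0%N q ltac:(lia); rewrite Dx; lia.
  by rewrite addn0; apply: ceil.
- by rewrite /bump_row eqxx Dx Dx1; lia.
- by rewrite /bump_row eqxx Dx; lia.
- by lia.
- by move=> j jq; apply: Xm; lia.
- move=> j jq; have [_ _ H3 _] := mir j (ltnW jq).
  have jq1 := mono j.+1 q ltac:(lia).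
  by rewrite gX; lia.
- by rewrite eqxx gX //; lia.
Qed.
End Mirror.

(** * Cover data and the stages of straightening *)

Definition row_start (k : nat) (lam : nat -> nat) (i : nat) : nat :=
  (i + k.+1 - lam i)%N.

(* The combinatorial datum behind a strong cover of the core of [lam], where
   [D = row_start k lam]: its components have height [h] and top rows
   [y, D y, ..., iter q D y], and the rows [u, ..., u + h - 2] are those in
   which [lam] increases. *)
Record cover_data (D : nat -> nat) (y q h u : nat) : Prop := CoverData {
  cover_height : (0 < h)%N;
  cover_top : forall a, D a <> y;
  cover_run : forall j i, (j <= q)%N -> (i < h)%N ->
    D (iter j D y + i)%N = (iter j.+1 D y + i)%N;
  cover_stop : D (iter q D y + h)%N <> (iter q.+1 D y + h)%N;
  cover_sep : (iter q D y + h <= iter q.+1 D y)%N;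
  cover_above : forall i, (i.+1 < h)%N -> D (u + i)%N = (y + i.+1)%N
}.

(** With [h - 1] rows raised and [h] lowered, the total drops by one, as it must for a strong cover.
    For a cover datum the truncation never acts, since [lam] is positive on the lowered rows. *)
Definition cover_weight (lam : nat -> nat) (z h u i : nat) : nat :=
  (lam i + (u <= i < u + h.-1) - (z <= i < z + h))%N.

Lemma increasing_mono (D : nat -> nat) : (forall i, D i < D i.+1)%N ->
  forall i j, (D i < D j)%N = (i < j)%N.
Proof. by move=> Dlt; apply: leqW_mono; apply: leq_mono;
  apply: homo_ltn ltn_trans _. Qed.

Lemma stage_indicators (b z u i a : nat) : (0 < b)%N ->
  ((u <= a < u + i.+1)%N -> (a < z)%N) ->
  (b + (z <= a < z + i.+1) - (u <= a < u + i) - (a == u + i)%N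
   + (a == (z + i).+1)%N)%N =
  (b + (z <= a < z + i.+2) - (u <= a < u + i.+1))%N.
Proof.
move=> b0; case ua: (u <= a < u + i.+1)%N => az; first have {}az := az isT.
  have -> : (z <= a < z + i.+1)%N = false by lia.
  have -> : (z <= a < z + i.+2)%N = false by lia.
  by lia.
have -> : (u <= a < u + i)%N = false by lia.
have -> : (a == u + i)%N = false by lia.
by case: (leqP z a); lia.
Qed.

Section Straightening.
Variables (l m d : nat) (D : nat -> nat) (lam : nat -> nat).
Hypothesis D_lt : forall i, (D i < D i.+1)%N.
Hypothesis D_gt : forall i, (i < D i)%N.
Hypothesis D_run : forall i, D i.+1 = (D i).+1 <-> lam i.+1 = lam i.
Local Notation HX := (lowered l m d).

Let D_mono := increasing_mono D_lt.

Lemma iter_mono y i j : (i <= j)%N -> (iter i D y <= iter j D y)%N.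
Proof.
elim: j => [|j IH]; first by case: i.
rewrite leq_eqVlt => /orP[/eqP -> //|]; rewrite ltnS => /IH ij.
by rewrite (leq_trans ij) // iterS ltnW.
Qed.

Section Stages.
Variables (y q u : nat).
Let X j := iter j D y.
Let z := X q.
Let c := X q.+1.
Hypothesis m_bounce : exists2 j, (j <= q)%N & X j = m.

(* [stage_start 1] and [stage_weight 1] describe what is left of lowering row [z]
   once the root [(z, D z)] is deleted. If the datum is a cover of height [h], the
   passage from [i] to [i + 1] costs a factor [t ^ (q + 1)], and stage [h] is the
   k-Schur function of the smaller core. Otherwise some stage [i <= h] vanishes. *)
Definition stage_start (i a : nat) : nat :=
  (D a + (z <= a < z + i) - (u <= a < u + i.-1))%N.
Definition stage_weight (i a : nat) : int :=
  (lam a)%:Z - (z <= a < z + i)%:Z + (u <= a < u + i.-1)%:Z.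

Definition aligned (i p : nat) : Prop :=
  forall i' j, (i' <= i)%N -> (p <= j <= q)%N -> D (X j + i') = (X j.+1 + i')%N.

(** Descent from [q]: if [X j.+1 <= X j + i], then [X j.+1] is itself an aligned row, so [D] shifts
    it as it shifts [X j]. The next gap on the path equals this one and is at most [i] too, against
    the case [j + 1]. *)
Lemma aligned_sep i p j : aligned i p -> (z + i < c)%N -> (p <= j <= q)%N ->
  (X j + i < X j.+1)%N.
Proof.
move=> al zc /andP[pj jq]; rewrite -(subKn jq); move: (leq_subr j q).
have : (q - (q - j) = j)%N by lia.
move: (q - j)%N => r; elim: r j pj jq => [|r IH] j pj jq rj rq.
  by rewrite subn0.
rewrite rj ltnNge; apply/negP => le.
have := IH j.+1 ltac:(lia) ltac:(lia) ltac:(lia) ltac:(lia).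
have -> : (q - r = j.+1)%N by lia.
have e : (X j + (X j.+1 - X j) = X j.+1)%N by have := D_gt (X j);
  rewrite /X iterS; lia.
have := al (X j.+1 - X j)%N j ltac:(lia) ltac:(lia); rewrite e.
have -> : D (X j.+1) = X j.+2 by [].
lia.
Qed.

Lemma aligned_weight i p j : aligned i.+1 p -> (p <= j <= q)%N ->
  lam (X j + i).+1%N = lam (X j + i)%N.
Proof.
by move=> al pj; apply/D_run; rewrite -addnS !al // addnS.
Qed.

Lemma aligned_mirror i p j : aligned i.+1 p -> (z + i.+1 < c)%N -> (p <= j <= q)%N ->
  mirror D (X j + i)%N (X j.+1 + i)%N.
Proof.
move=> al zc pj; have Xj := aligned_sep al zc pj.
split; first by rewrite al.
- by rewrite -addnS al // addnS.
- lia.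
move=> a; rewrite -addnS -(al i.+1 j) // => Da.
have := D_mono a (X j + i.+1); have := D_mono (X j + i.+1) a; rewrite Da; lia.
Qed.

(** The swaps below exchange rows [X j + i - 1] and [X j + i] with [0 < i]. The lower of the two
    lies strictly between consecutive path rows, hence is not [m]. *)
Lemma aligned_m i p j : aligned i p -> (z + i < c)%N -> (0 < i)%N ->
  (p <= j <= q)%N -> (X j + i)%N <> m.
Proof.
move=> al zc i0 pj; have Xj := aligned_sep al zc pj.
have [j0 j0q <-] := m_bounce; case: (leqP j0 j) => jj.
  by have := iter_mono y jj; rewrite -/(X j) -/(X j0); lia.
by have := iter_mono y jj; rewrite -/(X j.+1) -/(X j0); lia.
Qed.

(** The last block has grown until it meets row [c]. The root [(z, c)] is deleted and no other row
    starts in column [c], which gives the ceiling; rows [z + i] and [z + i + 1] now start together,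
    with weights in toggle position. *)
Lemma stage_fail_sep i : (forall i', i' < i -> D (u + i') = (y + i'.+1)%N)%N ->
  (forall i', i' <= i.+1 -> D (z + i') = c + i')%N ->
  (z + i.+1 = c)%N -> (z + i.+1 < l)%N ->
  HX (stage_start i.+1) (stage_weight i.+1) = 0.
Proof.
move=> Du Dz zi zil.
have yz : (y <= z)%N by apply: (iter_mono y (leq0n q)).
have uy a : (u <= a < u + i)%N -> (a < y + i /\ D a = y + (a - u).+1 /\ a < z + i)%N.
  move=> ua; have := Du (a - u)%N ltac:(lia); rewrite subnKC; last by lia.
  by have := D_gt a; lia.
have nu a : (z + i <= a)%N -> (u <= a < u + i)%N = false.
  by move=> za; apply/negP => /uy; lia.
have zi1 := nu (z + i)%N ltac:(lia); have zi2 := nu (z + i).+1 ltac:(lia).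
have Dzi := Dz i ltac:(lia); have Dzi1 := Dz i.+1 ltac:(lia).
rewrite addnS in Dzi1.
apply: (@lowered_toggle _ _ _ _ _ (z + i)).
- by lia.
- have [j0 j0q <-] := m_bounce.
  by have := iter_mono y j0q; rewrite -/(X j0) -/(X q) -/z; lia.
- rewrite /stage_start /= zi1 zi2 Dzi Dzi1; lia.
- rewrite /stage_start /= zi1 Dzi; lia.
- move=> a; apply/eqP; rewrite /stage_start /=.
  case ua: (u <= a < u + i)%N.
    by have [? [-> ?]] := uy a ua; lia.
  case za: (z <= a < z + i.+1)%N.
    by have := Dz (a - z)%N ltac:(lia); rewrite subnKC; lia.
  have cE : D z = c by [].
  move=> Da; have := D_mono a z; have := D_mono z a; rewrite cE; lia.
- have : lam (z + i).+1%N = lam (z + i)%N by apply/D_run; rewrite Dzi Dzi1 addnS.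
  by rewrite /stage_weight /= zi1 zi2; lia.
Qed.

(** Mirrors lead from row [X p + i] down to row [z + i], where the deleted roots have produced a
    wall. The column [X p + i.+1], in which no row starts, is the ceiling needed at the upper
    end. *)
Lemma stage_fail_ceil i p : (forall i', i' < i -> D (u + i') = (y + i'.+1)%N)%N ->
  (forall i' j, i' <= i -> j <= q -> D (X j + i') = X j.+1 + i')%N ->
  (p <= q)%N -> aligned i.+1 p -> (forall a, D a <> X p + i.+1)%N ->
  (z + i.+1 < c)%N -> (z + i.+1 < l)%N ->
  HX (stage_start i.+1) (stage_weight i.+1) = 0.
Proof.
move=> Du Dz pq al ceil zc zil.
have Xy j : (y <= X j)%N by apply: (iter_mono y (leq0n j)).
have Xz j : (j <= q)%N -> (X j <= z)%N by apply: iter_mono.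
have uy a : (u <= a < u + i)%N -> (a < y + i /\ D a = y + (a - u).+1)%N.
  move=> ua; have := Du (a - u)%N ltac:(lia); rewrite subnKC; last by lia.
  by have := D_gt a; lia.
have Dz1 a : (z <= a < z + i.+1)%N -> D a = (c + (a - z))%N.
  by move=> za; rewrite -(Dz (a - z)%N q) ?subnKC //; lia.
have nu a j : (X j + i <= a)%N -> (u <= a < u + i)%N = false.
  by move=> ja; apply/negP => /uy; have := Xy j; lia.
have sep j : (p <= j <= q)%N -> (X j + i.+1 < X j.+1)%N by apply: aligned_sep.
have SE j a : (p <= j < q)%N -> (a = X j + i \/ a = (X j + i).+1)%N ->
    stage_start i.+1 a = D a /\ stage_weight i.+1 a = (lam a)%:Z.
  move=> pj aj; rewrite /stage_start /stage_weight /= (nu a j); last by lia.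
  have := sep j ltac:(lia); have := Xz j.+1 ltac:(lia).
  by case: (z <= a < z + i.+1)%N / idP; lia.
have S_eq a b : (X p + i < b)%N -> (b <= z + i.+1)%N ->
  (stage_start i.+1 a = b -> D a = b)%N.
  move=> pb bz; rewrite /stage_start /=.
  case ua: (u <= a < u + i)%N.
    by have [? ->] := uy a ua; have := Xy p; lia.
  case za: (z <= a < z + i.+1)%N; first by rewrite Dz1 //; lia.
  by lia.
have pE j : (j <= q - p)%N -> (p <= p + j <= q)%N by lia.
have zE : (X (p + (q - p)) = z)%N by rewrite subnKC.
have [Dq Dq1 _ _] := aligned_mirror al zc (ltac:(lia) : (p <= q <= q)%N).
have nuz1 := nu (z + i)%N q ltac:(rewrite -/z; lia).
have nuz2 := nu (z + i).+1 q ltac:(rewrite -/z; lia).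
rewrite -/z -/c in Dq Dq1.
apply: (@mirror_vanish _ _ _ (q - p) _ (fun j => X (p + j) + i)%N).
- move=> j jq; have pj : (p <= p + j < q)%N by lia.
  have [M1 M2 M3 M4] := aligned_mirror al zc (pE j ltac:(lia)).
  have [E1 _] := SE _ _ pj (or_introl erefl).
  have [E2 _] := SE _ _ pj (or_intror erefl).
  split; rewrite ?E1 ?E2 ?addnS //.
  move=> a /S_eq Da; apply: M4; rewrite Da //.
    by have := iter_mono y (leqW (leq_addr j p));
      rewrite -/(X p) -/(X (p + j).+1); lia.
  by have := Xz (p + j).+1 ltac:(lia); lia.
- move=> a; rewrite addn0 => /S_eq Da; apply: (ceil a); rewrite addnS Da //.
  by have := Xz p pq; lia.
- by rewrite zE /stage_start /= nuz1 nuz2 Dq Dq1; lia.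
- by rewrite zE /stage_start /= nuz1 Dq; lia.
- by rewrite zE; lia.
- by move=> j jq; have := aligned_m al zc isT (pE j jq); rewrite addnS.
- move=> j jq; have pj : (p <= p + j < q)%N by lia.
  have [_ ->] := SE _ _ pj (or_introl erefl).
  have [_ ->] := SE _ _ pj (or_intror erefl).
  by rewrite (aligned_weight al) // pE //; lia.
- rewrite zE; have := aligned_weight al (ltac:(lia) : (p <= q <= q)%N);
  rewrite -/z => lz.
  by rewrite /stage_weight /= nuz1 nuz2; lia.
Qed.

(** Here row [u + i] starts in column [y + i.+1] and spoils the ceiling above the mirrors. One added
    root restores it, and the correction term this causes is carried along the path to row
    [z + i]. *)
Lemma stage_step i : (forall i', i' <= i -> D (u + i') = (y + i'.+1)%N)%N ->
  aligned i.+1 0 -> (z + i.+1 < c)%N -> (z + i.+1 < l)%N ->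
  HX (stage_start i.+1) (stage_weight i.+1) =
  tshift q.+1 (HX (stage_start i.+2) (stage_weight i.+2)).
Proof.
move=> Du al zc zil.
pose w := (u + i)%N.
have Dw : D w = (y + i).+1 by rewrite Du // addnS.
have Xy j : (y <= X j)%N by apply: (iter_mono y (leq0n j)).
have Xz j : (j <= q)%N -> (X j <= z)%N by apply: iter_mono.
have sep j : (j <= q)%N -> (X j + i.+1 < X j.+1)%N.
  by move=> jq; apply: aligned_sep al zc _.
have uyi a : (u <= a < u + i.+1)%N -> (D a = y + (a - u).+1 /\ a < y)%N.
  move=> ua; have Da : D a = (y + (a - u).+1)%N by rewrite -Du ?subnKC //; lia.
  split=> //; rewrite -D_mono Da; have := sep 0%N isT; rewrite /X /=; lia.
have wy : (w < y)%N by have [] := uyi w ltac:(rewrite /w; lia).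
have Dz1 a : (z <= a < z + i.+2)%N -> D a = (c + (a - z))%N.
  by move=> za; rewrite -(al (a - z)%N q) ?subnKC //; lia.
(* [D1] adds the root [(w, y + i)], which clears column [y + i + 1]; [g1] is the weight with row [w]
   raised. *)
pose D1 a := (stage_start i.+1 a - (a == w))%N.
pose g := stage_weight i.+1.
pose g1 a := g a + (a == w)%:Z.
have yz : (y <= z)%N := Xy q.
have nu a : (y <= a)%N -> [/\ (u <= a < u + i.+1)%N = false,
    (u <= a < u + i)%N = false & (a == w) = false].
  move=> ya; have H : (u <= a < u + i.+1)%N = false by apply/negP => /uyi; lia.
  by rewrite /w; split; lia.
have SE j a : (j < q)%N -> (a = X j + i \/ a = (X j + i).+1)%N ->
    D1 a = D a /\ g1 a = (lam a)%:Z.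
  move=> pj aj; rewrite /D1 /g1 /g /stage_start /stage_weight /=.
  have [_ -> ->] := nu a ltac:(have := Xy j; lia).
  have := sep j ltac:(lia); have := Xz j.+1 ltac:(lia).
  by case: (z <= a < z + i.+1)%N / idP; lia.
have S_eq a b : (y + i < b)%N -> (b <= z + i.+1)%N -> D1 a = b -> D a = b /\ a <> w.
  move=> pb bz; rewrite /D1 /stage_start /=.
  case ua: (u <= a < u + i.+1)%N.
    have [-> ay] := uyi a ua.
    have -> : (z <= a < z + i.+1)%N = false by lia.
    by rewrite /w; lia.
  have -> : (u <= a < u + i)%N = false by lia.
  case za: (z <= a < z + i.+1)%N; first by rewrite Dz1 //; lia.
  by rewrite /w; lia.
have [Dq Dq1 _ _] := aligned_mirror al zc (leqnn q : (0 <= q <= q)%N).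
rewrite -/z -/c in Dq Dq1.
have [nz1 nz2 nz3] := nu (z + i)%N ltac:(lia).
have [nz4 nz5 nz6] := nu (z + i).+1 ltac:(lia).
have mir j : (j < q)%N -> mirror D1 (X j + i)%N (X j.+1 + i)%N.
  move=> jq; have [M1 M2 M3 M4] := aligned_mirror al zc (ltnW jq : (0 <= j <= q)%N).
  have [E1 _] := SE _ _ jq (or_introl erefl).
  have [E2 _] := SE _ _ jq (or_intror erefl).
  split; rewrite ?E1 ?E2 //.
  move=> a /S_eq [] //; last by move=> /M4.
    by have := Xy j.+1; lia.
  by have := Xz j.+1 jq; lia.
have ceil a : D1 a <> (X 0 + i).+1.
  move=> /S_eq[]; rewrite /X /=; try lia.
  move=> Da; apply; have := D_mono a w; have := D_mono w a; lia.
have wall : D1 (z + i)%N = D1 (z + i).+1%N.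
  by rewrite /D1 /stage_start /= nz2 nz3 nz5 nz6 Dq Dq1; lia.
have Dz : D1 (z + i)%N = (c + i).+1%N.
  by rewrite /D1 /stage_start /= nz2 nz3 Dq; lia.
have Xm j : (j <= q)%N -> (X j + i).+1 <> m.
  by move=> jq; rewrite -addnS; apply: (aligned_m al zc).
have gX j : (j < q)%N -> g1 (X j + i).+1%N = g1 (X j + i)%N.
  move=> jq; have [_ ->] := SE _ _ jq (or_introl erefl).
  have [_ ->] := SE _ _ jq (or_intror erefl).
  by rewrite (aligned_weight al) //; lia.
have gz : g1 (z + i).+1%N = g1 (z + i)%N + 1.
  have := aligned_weight al (leqnn q : (0 <= q <= q)%N); rewrite -/z => lz.
  by rewrite /g1 /g /stage_weight /= nz2 nz3 nz5 nz6; lia.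
have zcl : ((z + i).+1 < D1 (z + i)%N)%N by rewrite Dz; lia.
have zil' : ((z + i).+1 < l)%N by lia.
have D1w : D1 w = (y + i)%N.
  rewrite /D1 /stage_start /= eqxx Dw;
    have -> : (z <= w < z + i.+1)%N = false by lia.
  by have -> : (u <= w < u + i)%N = false; [rewrite /w; lia | lia].
(* With the weight [g] the function of [D1] vanishes by the mirrors, so removing the added root
   leaves only the term with that root raised: a sign and one [t]. *)
have E1 : HX (stage_start i.+1) g =
    - tshift 1 (HX D1 (fun a => g1 a - (a == (y + i)%N)%:Z)).
  have b1E a : bump_row D1 w a = stage_start i.+1 a.
    rewrite /bump_row /D1.
    case: (a =P w) => [->|_]; last by rewrite subn0 addn0.
    by rewrite subnK //; move: D1w; rewrite /D1 eqxx; lia.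
  have := @lowered_recurrence l m d D1 g w; rewrite D1w => /(_ ltac:(lia)).
  rewrite (lowered_eq _ _ _ b1E (frefl g)) => e.
  apply/eqP; rewrite -addr_eq0; apply/eqP; apply: etrans (esym e) _.
  apply: (@mirror_vanish _ _ _ q D1 (fun j => X j + i)%N g) => //.
  - move=> j jq; have := gX j jq;
    have [_ _ ne] := nu (X j + i)%N ltac:(have := Xy j; lia).
    have [_ _ ne'] := nu (X j + i).+1 ltac:(have := Xy j; lia).
    by rewrite /g1 ne ne' !addr0.
  - by move: gz; rewrite -/z /g1 nz3 nz6 !addr0.
rewrite -/g E1 (_ : (y + i)%N = (X 0 + i)%N) //.
(* Moving the lowering from row [y + i] to row [z + i] supplies the remaining [t ^ q]. *)
rewrite (@mirror_transfer _ _ _ q D1 (fun j => X j + i)%N g1) //; last 2 first.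
- by rewrite -/z; lia.
- by move=> j jq; apply: Xm; lia.
rewrite tshift_tshift add1n -tshiftN; apply: (congr1 (tshift q.+1)).
(* Straightening rows [z + i] and [z + i + 1] moves the lowering one row further down and cancels
   the sign. *)
have sw : HX D1 (fun a => g1 a - (a == (z + i).+1)%:Z) =
    - HX D1 (fun a => g1 a - (a == X q + i)%N%:Z).
  apply: (@mirror_swap _ _ _ q D1 (fun j => X j + i)%N) => //; rewrite -/z.
  - move=> j jq; have := sep j (ltnW jq); have := Xz j.+1 jq => H1 H2.
    by rewrite gX //; lia.
  - by rewrite gz; lia.
  - by rewrite gz; lia.
  - by move=> a /negbTE -> /negbTE ->.
apply: etrans (esym sw) _.
have bE a : bump_row D1 (z + i).+1 a = stage_start i.+2 a.
  rewrite /bump_row /D1 /stage_start /w /=; apply: stage_indicators.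
    by have := D_gt a; lia.
  by move=> /uyi []; lia.
have gE a : g1 a - (a == (z + i).+1)%:Z = stage_weight i.+2 a.
  rewrite /g1 /g /stage_weight /w /=.
  by case: (leqP u a); case: (leqP z a); lia.
have D1z : D1 (z + i).+1 = (c + i).+1 by rewrite -wall.
(* The next stage also lacks the root [(z + i + 1, c + i + 1)]. Outside the first [l] columns this
   changes nothing; otherwise the term with this root raised vanishes by the mirrors. *)
case: (leqP l (c + i).+1) => cl.
  apply: lowered_ext => [a _|a b /andP[ab bl]]; first exact: gE.
  rewrite -bE /bump_row; case: (a =P (z + i).+1) => [->|_]; last by rewrite addn0.
  by rewrite D1z; lia.
rewrite (@lowered_recurrence _ _ _ D1 _ (z + i).+1); last by rewrite D1z; lia.
rewrite (lowered_eq _ _ _ bE gE) [X in tshift 1 X](_ : _ = 0) ?tshift0 ?addr0 //.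
apply: (@mirror_vanish _ _ _ q D1 (fun j => X j + i)%N) => //.
- move=> j jq; rewrite D1z; have := sep j (ltnW jq); have := Xz j.+1 jq => H1 H2.
  by rewrite gX //; lia.
- by rewrite -/z D1z gz; lia.
Qed.
End Stages.
End Straightening.

(** * Straightening for a bounded partition: a smaller core or zero *)

Section Weights.
Variables (k l m d : nat) (lam : nat -> nat).
Hypothesis lam_noninc : forall i, (lam i.+1 <= lam i)%N.
Hypothesis lam_k : forall i, (lam i <= k)%N.
Hypothesis lam_l : forall i, (l <= i)%N -> lam i = 0%N.
Local Notation D := (row_start k lam).
Local Notation HX := (lowered l m d).

Lemma row_start_lt i : (D i < D i.+1)%N.
Proof. by rewrite /row_start; have := lam_noninc i; have := lam_k i; lia. Qed.

Lemma row_start_gt i : (i < D i)%N.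
Proof. by rewrite /row_start; have := lam_k i; lia. Qed.

Lemma row_start_run i : D i.+1 = (D i).+1 <-> lam i.+1 = lam i.
Proof.
by rewrite /row_start; have := lam_noninc i; have := lam_k i; have := lam_k i.+1;
  lia.
Qed.

Let D_mono := increasing_mono row_start_lt.

Variables (y q : nat).
Hypothesis top : forall a, D a <> y.
Let X j := iter j D y.
Let z := X q.
Let c := X q.+1.
Hypothesis m_bounce : exists2 j, (j <= q)%N & X j = m.
Hypothesis z_l : (z < l)%N.
Let W := HX (bump_row D z) (fun i => (lam i)%:Z - (i == z)%:Z).

(** All later parts vanish as well, so the run of equal parts at [z] never stops, against
    [cover_stop]; and the tail sum of the lowered weight from [z] on is -1. *)
Lemma weight_zero : lam z = 0%N ->
  (forall h u, ~ cover_data D y q h u) /\ W = 0.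
Proof.
move=> lz; have l0 i : lam (z + i) = 0%N.
  by elim: i => [|i IH]; rewrite ?addn0 // addnS; have := lam_noninc (z + i); lia.
split.
  move=> h u [_ _ _ + _ _]; rewrite -/(X q) -/(X q.+1) -/z.
  have -> : X q.+1 = D z by []. by rewrite /row_start l0 lz; lia.
apply: (@lowered_vanish _ _ _ _ _ z).
rewrite (bigD1 (Ordinal z_l)) //= eqxx big1; first by rewrite lz.
move=> i /andP[zi]; rewrite -val_eqE /= => /negbTE ->.
by rewrite -(subnKC zi) l0.
Qed.

Lemma stage0 u : HX (stage_start D y q u 1) (stage_weight D lam y q u 1) = W.
Proof.
apply: lowered_eq => a; rewrite /stage_start /stage_weight /bump_row /= -/(X q)
  -/z; lia.
Qed.

(** At the first stage the interval beginning at [u] is empty, so [u] may still be chosen. *)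
Lemma stage_u u u' r : (u = u' \/ r = 0)%N ->
  HX (stage_start D y q u r.+1) (stage_weight D lam y q u r.+1) =
  HX (stage_start D y q u' r.+1) (stage_weight D lam y q u' r.+1).
Proof.
case=> [-> //|->].
by apply: lowered_eq => a; rewrite /stage_start /stage_weight /=; lia.
Qed.

Lemma stage_final h u : cover_data D y q h u -> lam z != 0%N ->
  (forall i, (i < h)%N -> lam (z + i) = lam z) ->
  HX (stage_start D y q u h) (stage_weight D lam y q u h) =
  HX (row_start k (cover_weight lam z h u))
     (fun i => (cover_weight lam z h u i)%:Z).
Proof.
move=> [h0 _ Xrun _ sep up] lz run.
have yz : (y <= z)%N by apply: (iter_mono row_start_gt y (leq0n q)).
have Ua a : (u <= a < u + h.-1)%N -> (a < y)%N.
  move=> ua; have := up (a - u)%N ltac:(lia); rewrite subnKC; last by lia.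
  rewrite -D_mono => ->.
  move: (Xrun 0%N h.-1 isT ltac:(lia)) => /= yr.
  have : (D y > y + h.-1)%N; last by lia.
  have al : aligned D y q h.-1 0 by move=> i' j ih jq; apply: Xrun; lia.
  have sp : (iter q D y + h.-1 < iter q.+1 D y)%N by lia.
  exact: (aligned_sep row_start_gt al sp (leq0n q : (0 <= 0 <= q)%N)).
have Za a : (z <= a < z + h)%N -> (0 < lam a)%N.
  by move=> za; have := run (a - z)%N ltac:(lia); rewrite subnKC; lia.
apply: lowered_eq => a; rewrite /stage_start /stage_weight /cover_weight /row_start
  -/(X q) -/z; have := lam_k a; have := Ua a; have := Za a;
  case: (u <= a < u + h.-1)%N; case: (z <= a < z + h)%N / idP; lia.
Qed.

(** On the last block, [cover_run] and [cover_stop] say that [h] is the length of the run of parts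
    equal to [lam z]. *)
Lemma cover_height_unique h h' u :
  (forall i, (i < h)%N -> lam (z + i) = lam z) -> lam (z + h) != lam z ->
  cover_data D y q h' u -> h' = h.
Proof.
move=> run stop [h0 _ Xrun + _ _].
rewrite -/(X q) -/(X q.+1) -/z => stop'.
have cE : X q.+1 = D z by [].
case: (ltngtP h' h) => // hh.
  by case: stop'; rewrite cE /row_start run //; have := lam_k z; lia.
move: (Xrun q h (leqnn q) hh); rewrite -/(X q) -/(X q.+1) -/z cE /row_start.
by have := lam_k z; have := lam_k (z + h); lia.
Qed.

Lemma straightening :
  (exists h u, cover_data D y q h u /\
     W = tshift (q.+1 * h.-1) (HX (row_start k (cover_weight lam z h u))
           (fun i => (cover_weight lam z h u i)%:Z))) \/
  ((forall h u, ~ cover_data D y q h u) /\ W = 0).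
Proof.
case: (eqVneq (lam z) 0%N) => [/weight_zero|lz]; first by right.
have [h] : exists h, [/\ (0 < h)%N, forall i, (i < h)%N -> lam (z + i) = lam z
    & lam (z + h) != lam z].
  have ex : exists h, lam (z + h) != lam z.
    by exists l; rewrite lam_l ?leq_addl // eq_sym.
  case: (ex_minnP ex) => h ne hmin; exists h; split=> //.
    by case: h ne {hmin} => //; rewrite addn0 eqxx.
  by move=> i ih; apply/eqP; apply: contraTT ih => /hmin; rewrite -leqNgt.
move=> [h0 run stop].
have cE : c = D z by [].
have Drun i : (i < h)%N -> D (z + i)%N = (c + i)%N.
  by move=> ih; rewrite cE /row_start run //; have := lam_k z; lia.
have zl i : (i < h)%N -> (z + i < l)%N.
  by move=> ih; rewrite ltnNge; apply/negP => /lam_l; rewrite run //; apply/eqP.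
have hE := cover_height_unique run stop.
(* The height grows by one at a time: the conditions on a cover hold as far as [r] and [W] is stage
   [r + 1] up to a power of [t], or a condition has failed for good. *)
suff claim r : (r < h)%N ->
  (exists u, [/\ forall i, (i < r)%N -> D (u + i)%N = (y + i.+1)%N,
     aligned D y q r 0, (z + r < c)%N &
     W = tshift (q.+1 * r) (HX (stage_start D y q u r.+1)
           (stage_weight D lam y q u r.+1))]) \/
  ((forall h u, ~ cover_data D y q h u) /\ W = 0).
  case: (claim h.-1); rewrite ?prednK //; last by right.
  move=> [u [Du al zc WE]]; left; exists h, u.
  have cd : cover_data D y q h u.
    split=> //.
    - by move=> j i jq ih; apply: al; lia.
    - rewrite -/(X q) -/(X q.+1) -/z -/c cE /row_start.
      move: stop => /eqP; have := lam_k z; have := lam_k (z + h); lia.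
    - by rewrite -/(X q) -/(X q.+1) -/z -/c; lia.
    - by move=> i ih; apply: Du; lia.
  split; first exact: cd.
  apply: etrans WE _; apply: (congr1 (tshift _)).
  exact: stage_final.
elim: r => [|r IH] rh.
  left; exists 0%N; split; last by rewrite muln0 tshift_0 stage0.
  - by [].
  - by move=> i' j; rewrite leqn0 => /eqP -> _; rewrite !addn0.
  - by rewrite addn0 cE row_start_gt.
case: (IH (ltnW rh)) => [|]; last by right.
move=> [u [Du al zc WE]].
have Xz : X q = z by [].
case: (eqVneq (z + r.+1)%N c) => [zrc|zrc].
  right; split.
    move=> h' u' cd; have hh := hE _ _ cd; have := cover_sep cd.
    by rewrite -/(X q) -/(X q.+1) -/z -/c hh; lia.
  apply: etrans WE _.
  rewrite (stage_fail_sep _ row_start_lt row_start_gt row_start_run m_bounce)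
    ?tshift0 //.
  - by move=> i' ir; apply: Drun; lia.
  - exact: (zl r.+1 rh).
have zc' : (z + r.+1 < c)%N by lia.
(* [p] will be the least index such that the rows [X j + r + 1] are aligned all the way from [j = p]
   to [q]. *)
pose ok j := D (X j + r.+1)%N == (X j.+1 + r.+1)%N.
have exok : exists p, (p <= q)%N && all ok (iota p (q - p).+1).
  by exists q; rewrite leqnn subnn /= andbT; apply/eqP/Drun.
case: (ex_minnP exok) => p /andP[pq /allP okp] pmin.
have alp : aligned D y q r.+1 p.
  move=> i' j; rewrite leq_eqVlt => /orP[/eqP ->|ir] jq.
    by apply/eqP/okp; rewrite mem_iota; lia.
  by apply: al; lia.
have fail : (forall a, D a <> X p + r.+1)%N -> W = 0.
  move=> ceil; apply: etrans WE _.
  rewrite (stage_fail_ceil _ row_start_lt row_start_gt row_start_run m_bounce (p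
    := p)) ?tshift0 //.
  exact: (zl r.+1 rh).
case: (posnP p) => p0; last first.
  have okn : ~~ ok p.-1.
    apply/negP => okp1; have : (p <= p.-1)%N; last by lia.
    apply: pmin; rewrite (leq_trans (leq_pred p)) //=.
    rewrite okp1 prednK // (_ : (q - p.-1)%N = (q - p).+1); last by lia.
    exact/allP.
  have Xp : X p = X (p.-1).+1 by rewrite prednK.
  right; split.
    move=> h' u' cd; have hh := hE _ _ cd.
    move/negP: okn; apply; apply/eqP.
    by apply: (cover_run cd); rewrite ?hh //; lia.
  (* [D] sends row [X p.-1 + r] to [X p + r] but the next row beyond [X p + r + 1]; being
     increasing, it misses that column. *)
  apply: fail => a Da.
  have := al r p.-1 (leqnn r) ltac:(lia);
    rewrite -/(X p.-1) -/(X (p.-1).+1) -Xp => Dp.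
  have := D_mono (X p.-1 + r) a; rewrite Da Dp => e1.
  have : (D (X p.-1 + r.+1) <= D a)%N.
    by rewrite leqNgt D_mono -leqNgt; lia.
  have := D_mono (X p.-1 + r) (X p.-1 + r.+1).
  by move/eqP: okn; rewrite Da Dp -Xp; lia.
rewrite p0 in alp fail.
have [[a Da]|Na] := pselect (exists a, D a = (y + r.+1)%N); last first.
  right; split; last by apply: fail => a Da; apply: Na; exists a.
  move=> h' u' cd; have hh := hE _ _ cd; apply: Na; exists (u' + r)%N.
  by apply: (cover_above cd); rewrite hh.
(* For [r > 0] monotonicity of [D] forces the new row to follow [u + r - 1]; for [r = 0] it defines
   [u]. *)
have ua : (r = 0 \/ a = u + r)%N.
  case: r Du {IH rh al zc WE zrc zc' ok exok pmin okp alp fail} Da => [|r] Du Da;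
    first by left.
  right; have Dr := Du r (ltnSn r).
  have := D_mono (u + r) a; have := D_mono (u + r.+1) a;
    have := row_start_lt (u + r).
  by rewrite Dr Da !addnS; lia.
have ra : (r <= a)%N by case: ua => [->//|->]; rewrite leq_addl.
left; exists (a - r)%N.
have Du' i : (i < r.+1)%N -> D (a - r + i)%N = (y + i.+1)%N.
  rewrite ltnS leq_eqVlt => /orP[/eqP ->|ir]; first by rewrite subnK.
  by case: ua => [|au]; [lia | rewrite au addnK Du].
split; [exact: Du' | exact: alp | exact: zc' |].
apply: etrans WE _; rewrite (@stage_u u (a - r)); last by case: ua => [|->];
  [right | left; rewrite addnK].
rewrite (stage_step _ row_start_lt row_start_gt row_start_run m_bounce) //.
- by rewrite tshift_tshift mulnS addnC.
- exact: (zl r.+1 rh).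
Qed.
End Weights.

(** * Cores *)

Section Partitions.
Local Open Scope nat_scope.
Implicit Types (s t : seq nat).
Local Notation row s i := (nth 0 s i).

Lemma partition_noninc s i j : is_partition s -> i <= j -> row s j <= row s i.
Proof.
move=> /andP[srt _] ij; case: (ltnP j (size s)) => js; last by rewrite nth_default.
apply: (sorted_leq_nth (leT := geq)) => //; rewrite ?inE //=.
- by move=> x y z /= yx xz; apply: leq_trans xz yx.
- exact: leqnn.
- exact: leq_ltn_trans js.
Qed.

Lemma partition_gt0 s i : is_partition s -> (0 < row s i) = (i < size s).
Proof.
move=> /andP[_ s0]; case: (ltnP i (size s)) => js; last by rewrite nth_default.
by rewrite lt0n; apply: contra s0 => /eqP <-; apply: mem_nth.
Qed.

Lemma partition_ext s t : is_partition s -> is_partition t ->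
  (forall i, row s i = row t i) -> s = t.
Proof.
move=> sP tP st; apply: (@eq_from_nth _ 0) => [|i _]; last exact: st.
have H i : (i < size s) = (i < size t) by rewrite -!partition_gt0 // st.
by have := H (size s); have := H (size t); rewrite !ltnn; lia.
Qed.

Lemma partition_exists (f : nat -> nat) l : (forall i, f i.+1 <= f i) ->
  (forall i, l <= i -> f i = 0) ->
  exists s, is_partition s /\ forall i, row s i = f i.
Proof.
move=> fle fl.
have fmono i j : i <= j -> f j <= f i.
  by elim: j => [|j IH]; [case: i | rewrite leq_eqVlt => /orP[/eqP -> //|];
     rewrite ltnS => /IH; apply: leq_trans].
have ex : exists n, f n == 0 by exists l; rewrite fl.
case: (ex_minnP ex) => n /eqP fn nmin.
have frow i : row (mkseq f n) i = f i.
  case: (ltnP i n) => ni; first by rewrite nth_mkseq.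
  by rewrite nth_default ?size_mkseq //; have := fmono n i ni;
    rewrite fn leqn0 => /eqP.
exists (mkseq f n); split=> //; apply/andP; split.
  apply/(sortedP 0) => i; rewrite size_mkseq => ni.
  by rewrite !frow /=; apply: fmono.
apply/negP => /(nthP 0)[i]; rewrite size_mkseq => ni; rewrite frow => fi.
by have := nmin i; rewrite fi eqxx => /(_ isT); rewrite leqNgt ni.
Qed.

Definition colen s c := count (fun p => c < p) s.

Lemma colenP s c i : is_partition s -> (i < colen s c) = (c < row s i).
Proof.
rewrite /colen; elim: s i => [|x s IH] i sP; first by rewrite nth_nil.
have sP' : is_partition s.
  move: sP; rewrite /is_partition inE negb_or =>
    /andP[/path_sorted -> /andP[_ ->]] //.
case: i => [|i] /=.
  case: (ltnP c x) => cx; first by rewrite addn_gt0.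
  rewrite add0n; case E : (0 < _) => //; move: E; rewrite (IH 0 sP').
  by have := @partition_noninc _ 0 1 sP isT; rewrite /=; lia.
rewrite -IH //; case: (ltnP c x) => cx; first by rewrite add1n ltnS.
rewrite add0n; rewrite (IH i.+1 sP') (IH i sP').
have := @partition_noninc _ 0 i.+1 sP isT; rewrite /=.
by have := @partition_noninc _ i i.+1 sP' (leqnSn i); lia.
Qed.

Lemma hook_colen s r c : is_partition s -> c < row s r ->
  hook s r c = colen s c - r.+1 + (row s r - c).
Proof.
move=> sP cr; congr (_ + _).
have rs : r < size s by rewrite -partition_gt0 //; lia.
rewrite /colen -[in RHS](cat_take_drop r.+1 s) count_cat.
suff -> : count (fun p => c < p) (take r.+1 s) = r.+1 by rewrite addKn.
rewrite (_ : count _ _ = size (take r.+1 s)); first by rewrite size_take_min; lia.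
apply/eqP; rewrite -all_count; apply/(all_nthP 0) => i.
rewrite size_take_min => ir; rewrite nth_take; last by lia.
by have := @partition_noninc s i r sP; lia.
Qed.

(* [j] is the row whose bead is [k + 1] positions below that of row [r]. *)
Definition shift_row k s r j := row s j + r + k.+1 = row s r + j.

(** If [row s j <= c], the column of the box ends above row [j] and the hook is at most [k];
    otherwise it reaches row [j] and the hook is at least [k + 2]. The value [k + 1] is skipped. *)
Lemma shift_row_hook k s r j c : is_partition s -> shift_row k s r j ->
  c < row s r -> (hook s r c <= k) = (row s j <= c) /\ hook s r c != k.+1.
Proof.
rewrite /shift_row => sP jr cr; rewrite hook_colen //.
have c1 : r < colen s c by rewrite colenP.
have := colenP c j sP; case: (leqP (row s j) c) => jc cj; last by split; lia.
have : colen s c <= j by lia.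
by move=> cj'; split; lia.
Qed.

(** Let [j] be the first row whose bead is not above the wanted position. If it were strictly below,
    the column [c] would have exactly [j] boxes, and [c] is chosen so that the box in row [r] then
    has hook length [k + 1]. *)
Lemma shift_row_exists k s r : is_core k s -> exists j, shift_row k s r j.
Proof.
move=> /andP[sP /allP core]; rewrite /shift_row.
case: (ltnP r (size s)) => rs; last first.
  by exists (r + k.+1); rewrite !nth_default //; lia.
have ex : exists j, row s j + r + k.+1 <= row s r + j.
  by exists (size s + r + k.+1); rewrite nth_default; lia.
case: (ex_minnP ex) => j jle jmin; exists j.
case: (ltngtP (row s j + r + k.+1) (row s r + j)) => // jlt; last by lia.
have rj : r < j.
  by rewrite ltnNge; apply/negP => jr; have := @partition_noninc s j r sP jr; lia.
pose c := row s r + j - (r + k.+2).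
have jm : row s r + j.-1 < row s j.-1 + r + k.+1.
  by rewrite ltnNge; apply/negP => /jmin; lia.
have cr : c < row s r.
  by have := @partition_noninc s r j.-1 sP ltac:(lia); rewrite /c; lia.
have := core r; rewrite mem_iota /= => /(_ rs) /allP /(_ c).
rewrite mem_iota /= => /(_ cr); rewrite hook_colen // => /eqP[].
have cj : colen s c = j.
  by have := colenP c j sP; have := colenP c j.-1 sP; rewrite /c; lia.
by rewrite cj /c; lia.
Qed.

Lemma is_core_shift k s : is_partition s ->
  (forall r, exists j, shift_row k s r j) ->
  is_core k s.
Proof.
move=> sP sh; rewrite /is_core sP; apply/allP => r _; apply/allP => c.
rewrite mem_iota => /= cr; have [j jr] := sh r.
by have [] := shift_row_hook sP jr cr.
Qed.

Lemma row_pmap_core k s r j : is_partition s -> shift_row k s r j ->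
  row (pmap_core k s) r = row s r - row s j.
Proof.
move=> sP jr; case: (ltnP r (size s)) => rs; last first.
  rewrite [LHS]nth_default; last by rewrite size_map size_iota.
  by rewrite (nth_default _ rs).
rewrite (nth_map 0) ?size_iota // nth_iota // add0n.
rewrite (@eq_in_count _ _ (fun c => row s j <= c)); last first.
  by move=> c; rewrite mem_iota => /= cr; have [] := shift_row_hook sP jr cr.
elim: (row s r) => [|n IH]; first by rewrite sub0n.
rewrite -addn1 iotaD count_cat IH /= add0n addn0.
by case: leqP; lia.
Qed.

(** The recursion puts the bead of row [row_start k mu i] exactly [k + 1] below that of row [i],
    which is the abacus condition for a core. *)
Lemma core_intro k s (mu : nat -> nat) : is_partition s -> (forall i, mu i <= k) ->
  (forall i, row s i = mu i + row s (row_start k mu i)) ->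
  is_core k s /\ forall i, row (pmap_core k s) i = mu i.
Proof.
move=> sP mk rec.
have sh r : shift_row k s r (row_start k mu r).
  by rewrite /shift_row (rec r) /row_start; have := mk r; lia.
split; first by apply: is_core_shift => // r; eexists; apply: sh.
by move=> i; rewrite (row_pmap_core sP (sh i)) rec addnK.
Qed.

Section Core.
Variables (k : nat) (s : seq nat).
Hypothesis s_core : is_core k s.
Local Notation mu := (nth 0 (pmap_core k s)).

Let s_part : is_partition s. Proof. by have /andP[] := s_core. Qed.

Let mu_shift i : mu i <= row s i /\ shift_row k s i (row_start k mu i).
Proof.
have [j jr] := shift_row_exists i s_core.
have ij : i < j.
  rewrite ltnNge; apply/negP => ji; have := @partition_noninc s j i s_part ji.
  by move: jr; rewrite /shift_row; lia.
have := @partition_noninc s i j s_part (ltnW ij) => ij'.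
have muE := row_pmap_core s_part jr.
rewrite (_ : row_start k mu i = j); first by split=> //; rewrite muE; lia.
by move: jr; rewrite /row_start /shift_row muE; lia.
Qed.

Lemma core_rows i : row s i = mu i + row s (row_start k mu i).
Proof. by have [? sh] := mu_shift i; rewrite (row_pmap_core s_part sh); move: sh;
  have := @partition_noninc s i (row_start k mu i) s_part;
    rewrite /row_start /shift_row; lia. Qed.

Lemma core_mu_le i : mu i <= k.
Proof.
have [mi sh] := mu_shift i.
have : i < row_start k mu i; last by rewrite /row_start; lia.
rewrite ltnNge; apply/negP => ji.
by have := @partition_noninc s _ i s_part ji; move: sh; rewrite /shift_row; lia.
Qed.

(** Beads decrease strictly, and so do their translates by [k + 1]; hence [row_start] increases
    strictly, which amounts to weakly decreasing parts. *)
Lemma core_mu_noninc i : mu i.+1 <= mu i.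
Proof.
have [_ sh] := mu_shift i; have [_ sh1] := mu_shift i.+1.
have := @partition_noninc s i i.+1 s_part (leqnSn i).
have : row_start k mu i < row_start k mu i.+1.
  rewrite ltnNge; apply/negP => ji; have := @partition_noninc s _ _ s_part ji.
  have := @partition_noninc s i i.+1 s_part (leqnSn i).
  by move: sh sh1; rewrite /shift_row; lia.
by rewrite /row_start; have := core_mu_le i; have := core_mu_le i.+1; lia.
Qed.

(** After a zero part all parts are zero, and the recursion copies row [i] from ever later rows,
    finally from an empty one. *)
Lemma core_mu_size i : (0 < mu i) = (i < size s).
Proof.
case: (ltnP i (size s)) => is_; last first.
  by rewrite nth_default // size_map size_iota.
rewrite lt0n; apply/negP => /eqP mi0.
have mu0 j : i <= j -> mu j = 0.
  elim: j => [|j IH]; first by rewrite leqn0 => /eqP i0; move: mi0; rewrite i0.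
  rewrite leq_eqVlt => /orP[/eqP ij|]; first by rewrite -ij.
  rewrite ltnS => /IH mj.
  by have := core_mu_noninc j; lia.
have s0 n j : i <= j -> size s <= n + j -> row s j = 0.
  elim: n j => [|n IH] j ij sj; first by rewrite nth_default.
  by rewrite core_rows mu0 // add0n IH // /row_start mu0 //; lia.
have := partition_gt0 i s_part; rewrite is_ (s0 (size s)) //; lia.
Qed.
End Core.

Lemma core_inj k s t : is_core k s -> is_core k t ->
  (forall i, row (pmap_core k s) i = row (pmap_core k t) i) -> s = t.
Proof.
move=> sC tC st; apply: partition_ext.
- by case/andP: sC.
- by case/andP: tC.
have H n i : maxn (size s) (size t) <= n + i -> row s i = row t i.
  elim: n i => [|n IH] i ni; first by rewrite !nth_default //; lia.
  rewrite (core_rows sC) (core_rows tC) /row_start st; congr (_ + _).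
  by apply: IH; have := core_mu_le tC i; lia.
by move=> i; apply: (H (maxn (size s) (size t))); rewrite leq_addr.
Qed.

Lemma core_exists k l (mu : nat -> nat) : (forall i, mu i.+1 <= mu i) ->
  (forall i, mu i <= k) -> (forall i, l <= i -> mu i = 0) ->
  exists s, is_core k s /\ forall i, row (pmap_core k s) i = mu i.
Proof.
move=> mule muk mul.
(* The recursion [core_rows] solved with fuel: each call moves to a later row and the rows from [l]
   on are empty, so fuel [l] suffices. *)
pose kf := fix kf (f i : nat) {struct f} :=
  if f is f'.+1 then mu i + kf f' (row_start k mu i) else 0.
have gt i : i < row_start k mu i by apply: row_start_gt.
have stab f i : l <= f + i -> kf f.+1 i = kf f i.
  elim: f i => [|f IH] i li; first by rewrite /= mul.
  have -> : kf f.+2 i = mu i + kf f.+1 (row_start k mu i) by [].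
  by rewrite IH //; have := gt i; lia.
have rec i : kf l i = mu i + kf l (row_start k mu i).
  by rewrite -stab // leq_addr.
have kl f i : l <= i -> kf f i = 0.
  elim: f i => [|f IH] i li //=; rewrite mul // IH //.
  by have := gt i; lia.
have le n i : l <= n + i -> forall j, i <= j -> kf l j <= kf l i.
  elim: n i => [|n IH] i ni j ij; first by rewrite kl //; lia.
  rewrite (rec i) (rec j).
  have ij' : row_start k mu i <= row_start k mu j.
    have mono := increasing_mono (row_start_lt mule muk).
    by rewrite leqNgt mono -leqNgt.
  have mij : mu j <= mu i.
    elim: j ij {ij'} => [|j IHj]; first by case: (i).
    rewrite leq_eqVlt => /orP[/eqP -> //|]; rewrite ltnS => /IHj.
    exact: leq_trans.
  apply: leq_add => //; apply: IH => //; have := gt i; lia.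
have [s [sP srow]] := @partition_exists (kf l) l
  (fun i => le l i (leq_addr _ _) i.+1 (leqnSn i)) (kl l).
exists s; apply: core_intro => // i; rewrite !srow; exact: rec.
Qed.
End Partitions.

(** * The strong cover attached to a cover datum *)

Lemma sum_interval a h n : (a + h <= n)%N ->
  (\sum_(i < n) (a <= i < a + h)%N = h)%N.
Proof.
move=> ahn; rewrite -(big_mkord xpredT (fun i => (a <= i < a + h)%N : nat)).
rewrite (big_cat_nat _ (n := a)) //=; last by lia.
rewrite (big_cat_nat _ (m := a) (n := (a + h)%N)) //=; last by lia.
rewrite [X in (X + _)%N]big_nat_cond big1 ?add0n; last by move=> i; lia.
rewrite [X in (_ + X)%N]big_nat_cond [X in (_ + X)%N]big1 ?addn0; last first.
  by move=> i; lia.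
rewrite big_nat_cond (eq_bigr (fun=> 1%N)); last by move=> i; lia.
by rewrite -big_nat_cond sum_nat_const_nat muln1 addKn.
Qed.

Lemma card_interval a h n : (a + h <= n)%N ->
  #|[set i : 'I_n | (a <= i < a + h)%N]| = h.
Proof.
move=> ahn; rewrite -sum1_card -[RHS](sum_interval ahn) big_mkcond /=.
by apply: eq_bigr => i _; rewrite inE; case: ifP.
Qed.

Lemma sumn_nth (s : seq nat) n : (size s <= n)%N ->
  sumn s = (\sum_(i < n) nth 0 s i)%N.
Proof.
elim: s n => [|x s IH] [|n] //= sn.
- by rewrite big1 // => i _; rewrite nth_nil.
- by rewrite big1 // => i _; rewrite nth_nil.
- by rewrite big_ord_recl /= -IH.
Qed.

Section CoverWeight.
Local Open Scope nat_scope.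
Variables (k : nat) (mu : nat -> nat).
Hypothesis mu_noninc : forall i, mu i.+1 <= mu i.
Hypothesis mu_k : forall i, mu i <= k.
Local Notation D := (row_start k mu).
Variables (y q h u : nat).
Hypothesis cd : cover_data D y q h u.
Let X j := iter j D y.
Let z := X q.
Let c := X q.+1.
Let D_lt := row_start_lt mu_noninc mu_k.
Let D_gt := row_start_gt mu_k.
Let D_mono := increasing_mono D_lt.

Lemma cover_block_sep j : j <= q -> X j + h <= X j.+1.
Proof.
case: cd => h0 _ run _ sep _ jq.
have al : aligned D y q h.-1 0 by move=> i' i ih iq; apply: run; lia.
have sp : iter q D y + h.-1 < iter q.+1 D y by lia.
by have := aligned_sep D_gt al sp (jq : 0 <= j <= q); rewrite -/(X j) -/(X j.+1);
  lia.
Qed.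

Lemma cover_above_lt a : u <= a < u + h.-1 -> a < y /\ D a = y + (a - u).+1.
Proof.
case: cd => h0 _ run _ _ up ua.
have Da : D a = y + (a - u).+1 by rewrite -up ?subnKC //; lia.
split=> //; rewrite -D_mono Da.
by have := cover_block_sep (leq0n q); rewrite /X /=; lia.
Qed.

Lemma cover_top_row_le j : y <= X j.
Proof. exact: (iter_mono D_gt y (leq0n j)). Qed.

Lemma cover_rows_le i j : i <= j -> X i <= X j.
Proof. exact: iter_mono. Qed.

Lemma cover_mu_run j i : j <= q -> i < h -> mu (X j + i) = mu (X j).
Proof.
case: cd => h0 _ run _ _ _ jq ih.
have := run j i jq ih; have := run j 0 jq h0; rewrite !addn0 -/(X j) -/(X j.+1).
by have := mu_k (X j + i); have := mu_k (X j); rewrite /row_start; lia.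
Qed.

Lemma cover_mu_gt0 i : i < h -> 0 < mu (z + i).
Proof.
case: cd => h0 _ run stop _ _ ih; rewrite cover_mu_run // lt0n; apply/eqP => mz0.
have m0 a : mu (z + a) = 0.
  by elim: a => [|a IH]; rewrite ?addn0 ?addnS //; have := mu_noninc (z + a); lia.
have cE : c = D z by [].
by apply: stop; rewrite -/(X q) -/(X q.+1) -/z -/c cE /row_start m0 mz0; lia.
Qed.

Lemma cover_mu_stop : mu (z + h) < mu z.
Proof.
case: cd => h0 _ run stop _ _.
have : mu (z + h) <= mu z.
  elim: (h) => [|a IH]; first by rewrite addn0.
  by rewrite addnS; apply: leq_trans (mu_noninc _) IH.
rewrite leq_eqVlt => /orP[/eqP e|//]; case: stop.
rewrite -/(X q) -/(X q.+1) -/z; have -> : X q.+1 = D z by [].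
by rewrite /row_start e; have := mu_k z; lia.
Qed.

(** Since the run stops at row [z + h], that row starts beyond [c + h]; and row [c] comes no earlier
    than row [z + h]. *)
Lemma cover_gap : c + h < D c.
Proof.
case: cd => h0 _ run stop sep _.
have st : D (z + h) <> c + h by [].
have := D_mono (z + h.-1) (z + h); have := run q h.-1 (leqnn q).
rewrite -/(X q) -/(X q.+1) -/z -/c.
have : D (z + h) <= D c by rewrite leqNgt D_mono -leqNgt.
lia.
Qed.

Lemma cover_weight_noninc i :
  cover_weight mu z h u i.+1 <= cover_weight mu z h u i.
Proof.
case: cd => h0 top run stop sep up.
have := mu_noninc i; have := cover_mu_stop;
  have := cover_mu_run (leqnn q) (i := h.-1).
rewrite -/z => mz ms mi; have yz : y <= z := cover_top_row_le q.
have U a := @cover_above_lt a.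
(* Monotonicity is at risk only at row [z + h], where the run ends, and at the first raised row [u],
   where the starts jump over the column [y]; the parts of [mu] drop strictly at both. *)
have Z : i.+1 = z + h -> mu i.+1 < mu i.
  by move=> iz; rewrite iz (_ : i = z + h.-1) ?mz //; lia.
have Ui : i.+1 = u -> 1 < h -> mu i.+1 < mu i.
  move=> iu h1; have Du := up 0 h1; rewrite addn0 -iu in Du.
  have := top i; have := D_lt i; move: Du; rewrite /row_start.
  by have := mu_k i; have := mu_k i.+1; lia.
have := U i; have := U i.+1; rewrite /cover_weight.
have m0 : z <= i < z + h -> 0 < mu i.
  by move=> zi; have := @cover_mu_gt0 (i - z); rewrite subnKC; lia.
move: mi Z Ui m0; clear - yz h0.
case: (boolP (u <= i < u + h.-1)) => a1; case: (boolP (u <= i.+1 < u + h.-1)) => a2;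
case: (boolP (z <= i < z + h)) => a3; case: (boolP (z <= i.+1 < z + h)) => a4; lia.
Qed.

Lemma cover_weight_le i : cover_weight mu z h u i <= k.
Proof.
rewrite /cover_weight; case: (boolP (u <= i < u + h.-1)) => /= ui; last first.
  by have := mu_k i; lia.
have [iy] := cover_above_lt ui; rewrite /row_start.
by have := mu_k i; lia.
Qed.

Lemma cover_weight_zero n i : (forall i, n <= i -> mu i = 0) -> n <= i ->
  cover_weight mu z h u i = 0.
Proof.
move=> mu0 ni; rewrite /cover_weight mu0 // add0n.
case: (boolP (u <= i < u + h.-1)) => //= ui.
have [iy _] := cover_above_lt ui; have := @cover_mu_gt0 0 (cover_height cd).
have yz : y <= z := cover_top_row_le q.
by rewrite addn0 mu0 //; lia.
Qed.

End CoverWeight.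

(** * The smaller core: its rows and the components of the difference *)

Section Cover.
Local Open Scope nat_scope.
Variables (k : nat) (s t : seq nat).
Hypothesis s_core : is_core k s.
Hypothesis t_core : is_core k t.
Local Notation row s i := (nth 0 s i).
Local Notation mu := (nth 0 (pmap_core k s)).
Local Notation D := (row_start k mu).
Variables (y q h u : nat).
Hypothesis cd : cover_data D y q h u.
Let X j := iter j D y.
Let z := X q.
Let c := X q.+1.
Hypothesis t_mu : forall i, nth 0 (pmap_core k t) i = cover_weight mu z h u i.

Let mu_noninc := core_mu_noninc s_core.
Let mu_k := core_mu_le s_core.
Let D_mono := increasing_mono (row_start_lt mu_noninc mu_k).
Let s_part : is_partition s. Proof. by case/andP: s_core. Qed.
Let sep j : j <= q -> X j + h <= X j.+1.
Proof. exact: (cover_block_sep mu_k cd). Qed.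
Let Xy j : y <= X j. Proof. exact: cover_top_row_le. Qed.
Let Xle i j : i <= j -> X i <= X j. Proof. exact: cover_rows_le. Qed.
Let z_gt0 i : i < h -> 0 < mu (z + i).
Proof. exact: (cover_mu_gt0 mu_noninc mu_k cd). Qed.

Definition in_block (i : nat) : bool := has (fun j =>
  X j <= i < X j + h) (iota 0 q.+1).

Lemma in_blockP i : reflect (exists2 j, j <= q & X j <= i < X j + h) (in_block i).
Proof.
apply: (iffP hasP) => -[j]; first by rewrite mem_iota add0n => jq; exists j.
by move=> jq ij; exists j => //; rewrite mem_iota.
Qed.

(** [D] carries each block to the next and [mu] is constant on a block, so all blocks, and the rows
    from [c] on, have the same profile. *)
Lemma cover_telescope j i : j <= q -> i < h ->
  row s (X j + i) + row s c = row s (X j) + row s (c + i).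
Proof.
move=> jq ih; rewrite -(subKn jq); have : q - (q - j) <= q by lia.
elim: (q - j) (leq_subr j q) => [|r IH] rq _.
  rewrite subn0 (core_rows s_core (X q + i)) (core_rows s_core (X q)).
  rewrite (cover_run cd) // -/(X q.+1) -/c (cover_mu_run _ cd) //.
  by rewrite (_ : D (X q) = c) // -/(X q); lia.
rewrite (core_rows s_core (X _ + i)) (core_rows s_core (X (q - r.+1))).
rewrite (cover_run cd) //; last by lia.
rewrite (cover_mu_run _ cd) //; last by lia.
have -> : D (X (q - r.+1)) = X (q - r.+1).+1 by [].
have := IH ltac:(lia) ltac:(lia).
rewrite -/(X _.+1) (_ : (q - r.+1).+1 = q - r); last by lia.
by rewrite -/(X _); lia.
Qed.

(** Induction from the last row upwards, comparing the recursions of [s] and [t]. The three claims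
    describe one ribbon removed per block and depend on each other: a raised row refers to block 0,
    a block to the next one, and the last block to rows outside all blocks. *)
Lemma cover_rows_aux n i : maxn (size s) (size t) <= n + i ->
  [/\ ~~ in_block i -> row t i = row s i,
      forall j i', j <= q -> i'.+1 < h -> i = X j + i' -> (row t i).+1 = row s i.+1
    & forall j, j <= q -> i = X j + h.-1 ->
        (row t i + row s c).+1 = row s (X j) + row s (c + h)].
Proof.
have [h0 top run stop sepq up] := cd.
have yz : y <= z := Xy q.
have Ut a := cover_above_lt mu_noninc mu_k cd (a := a).
elim: n i => [|n IH] i ni.
  have si : size s <= i by lia.
  have ti : size t <= i by lia.
  have nb j i' : j <= q -> i' < h -> i <> X j + i'.
    move=> jq ih iX; have := core_mu_size s_core (z + i').
    rewrite z_gt0 // => /esym; have := Xle jq.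
    by rewrite -/z; lia.
  split; first by rewrite !nth_default.
    by move=> j i' jq ih iX; have [] := nb j i' jq ltac:(lia).
  by move=> j jq iX; have [] := nb j h.-1 jq ltac:(lia).
have D'E a : row_start k (cover_weight mu z h u) a =
    D a + (z <= a < z + h) - (u <= a < u + h.-1).
  rewrite /cover_weight /row_start; have := @mu_k a; have := Ut a.
  have : z <= a < z + h -> 0 < mu a.
    by move=> za; have := @z_gt0 (a - z); rewrite subnKC; lia.
  by case: (boolP (u <= a < u + h.-1)); case: (boolP (z <= a < z + h));
    rewrite /row_start; lia.
have trow a : row t a = cover_weight mu z h u a +
    row t (D a + (z <= a < z + h) - (u <= a < u + h.-1)).
  rewrite (core_rows t_core) t_mu -D'E; congr (_ + row t _).
  by rewrite /row_start t_mu.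
have gt a : a < D a by apply: row_start_gt.
have Xlt j : X j < X j.+1 := gt (X j).
have zc : z < c := gt z.
have IHs a : i < a -> _ := fun ia => IH a ltac:(lia).
have blk j i' : j <= q -> i' < h -> in_block (X j + i').
  by move=> jq ih; apply/in_blockP; exists j => //; lia.
have cnb a : z + h <= a -> ~~ in_block a.
  by move=> za; apply/in_blockP => -[j jq]; have := Xle jq; rewrite -/z -/(X j); lia.
have Bu j i' : j <= q -> (u <= X j + i' < u + h.-1) = false.
  by move=> jq; apply/negP => /Ut[]; have := Xy j; rewrite -/(X j); lia.
have Bz j i' : j < q -> i' < h -> (z <= X j + i' < z + h) = false.
  by move=> jq ih; have := sep (ltnW jq); have := Xle jq;
    rewrite -/z -/(X j) -/(X j.+1); lia.
have Zz i' : i' < h -> z <= z + i' < z + h by lia.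
have b0 : nat_of_bool false = 0 by [].
have b1 : nat_of_bool true = 1 by [].
split.
- move=> nb.
  (* A raised row refers to row [y + (i - u)] of [t], which is one box shorter than the following
     row of [s]; the raise makes up for it. *)
  case ui: (u <= i < u + h.-1).
    have [iy Di] := Ut i ui.
    have zi : (z <= i < z + h) = false by lia.
    rewrite trow (core_rows s_core i) /cover_weight ui zi Di /=.
    have [_ T2 _] := IHs (y + (i - u)) ltac:(lia).
    have := T2 0 (i - u) (leq0n q) ltac:(lia) erefl.
    by rewrite subn0 addn0 -addnS;
      rewrite (_ : y + (i - u).+1 - 1 = y + (i - u)); lia.
  have zi : (z <= i < z + h) = false.
    by apply/negP => zi; move/negP: nb; apply; apply/in_blockP; exists q.
  rewrite trow (core_rows s_core i) /cover_weight ui zi !subn0 !addn0; congr (_ + _).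
  have [T1 _ _] := IHs (D i) (gt i); apply: T1.
  (* [D] does not lead into a block from outside: [y] is not a value of [D], the other rows of block
     0 come from raised rows, and each later block comes from the one before it. *)
  apply/in_blockP => -[[|j] jq Dj].
    case: (eqVneq (D i) y) => [/top //|Dy].
    have := up (D i - y).-1 ltac:(move: Dj; rewrite /X /=; lia).
    rewrite prednK; last by move: Dj; rewrite /X /=; lia.
    rewrite subnKC; last by move: Dj; rewrite /X /=; lia.
    move=> Du; have := D_mono i (u + (D i - y).-1);
      have := D_mono (u + (D i - y).-1) i.
    by rewrite Du; move: Dj ui; rewrite /X /=; lia.
  have := run j (D i - X j.+1) (ltnW jq) ltac:(lia).
  rewrite -/(X j) -/(X j.+1) subnKC; last by lia.
  move=> Dj'; have := D_mono i (X j + (D i - X j.+1)).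
  have := D_mono (X j + (D i - X j.+1)) i; rewrite Dj' => e1 e2.
  move/negP: nb; apply; rewrite (_ : i = X j + (D i - X j.+1)); last by lia.
  by apply: blk; lia.
- move=> j i' jq ih iX; rewrite iX trow -[in RHS](addnS (X j)) (core_rows s_core
  (X j + i'.+1)).
  rewrite /cover_weight Bu // b0 addn0 subn0 (cover_run cd) // ?(ltnW ih) //.
  rewrite (cover_run cd) // !(cover_mu_run _ cd) // ?(ltnW ih) // -/(X j) -/(X j.+1).
  have [jq'|jq'] := ltnP j q.
    rewrite Bz ?(ltnW ih) // b0 subn0 addn0.
    have [_ T2 _] := IHs (X j.+1 + i') ltac:(have := Xlt j; lia).
    have := T2 j.+1 i' jq' ih erefl; rewrite addnS; lia.
  have jE : j = q by lia.
  rewrite jE -/z in iX; rewrite jE -/z -/c Zz ?(ltnW ih) // b1.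
  have [T1 _ _] := IHs (c + i'.+1) ltac:(lia).
  rewrite -addnA addn1 T1; last by apply: cnb; have := sep (leqnn q);
    rewrite -/z -/c; lia.
  by have := z_gt0 h0; rewrite addn0; lia.
- move=> j jq iX; rewrite iX trow (core_rows s_core (X j)).
  have h1 : h.-1 < h by lia.
  rewrite /cover_weight Bu // b0 addn0 subn0 (cover_run cd) // (cover_mu_run _
    cd) // -/(X j) -/(X j.+1).
  have -> : D (X j) = X j.+1 by [].
  have [jq'|jq'] := ltnP j q.
    rewrite Bz // b0 subn0 addn0.
    have [_ _ T3] := IHs (X j.+1 + h.-1) ltac:(have := Xlt j; lia).
    by have := T3 j.+1 jq' erefl; lia.
  have jE : j = q by lia.
  rewrite jE -/z in iX; rewrite jE -/z -/c Zz // b1.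
  have [T1 _ _] := IHs (c + h) ltac:(lia).
  rewrite (_ : c + h.-1 + 1 = c + h); last by lia.
  rewrite T1; last by apply: cnb; have := sep (leqnn q); rewrite -/z -/c; lia.
  by have := z_gt0 h0; rewrite addn0; lia.
Qed.

Lemma cover_row_out i : ~~ in_block i -> row t i = row s i.
Proof. by have [T _ _] := @cover_rows_aux (maxn (size s) (size t)) i (leq_addr _
  _). Qed.

Lemma cover_row_in j i : j <= q -> i.+1 < h ->
  (row t (X j + i)).+1 = row s (X j + i).+1.
Proof.
move=> jq ih; have [_ T _] :=
  @cover_rows_aux (maxn (size s) (size t)) (X j + i) (leq_addr _ _).
exact: T jq ih erefl.
Qed.

Lemma cover_row_last j : j <= q ->
  (row t (X j + h.-1) + row s c).+1 = row s (X j) + row s (c + h).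
Proof.
move=> jq; have [_ _ T] := @cover_rows_aux (maxn (size s) (size t)) (X j + h.-1)
  (leq_addr _ _).
exact: T jq erefl.
Qed.

Let h0 : 0 < h. Proof. exact: cover_height cd. Qed.

Lemma block_row_lt j i : j <= q -> i < h -> row t (X j + i) < row s (X j + i).
Proof.
move=> jq ih; case: (ltnP i.+1 h) => ih1.
  by rewrite cover_row_in // partition_noninc.
have -> : i = h.-1 by lia.
have := cover_row_last jq; have := cover_telescope jq (i := h.-1) ltac:(lia).
rewrite -/(X j) -/(X q.+1) -/c.
by have := @partition_noninc s (c + h.-1) (c + h) s_part ltac:(lia); lia.
Qed.

Lemma cover_contained_row i : row t i <= row s i.
Proof.
case: (boolP (in_block i)) => [/in_blockP[j jq ij]|/cover_row_out -> //].
have := @block_row_lt j (i - X j) jq; rewrite subnKC; last by lia.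
by move=> lt; apply: ltnW; apply: lt; lia.
Qed.

Lemma block_size j i : j <= q -> i < h -> X j + i < size s.
Proof.
by move=> jq ih; rewrite -partition_gt0 //; have := block_row_lt jq ih; lia.
Qed.

Lemma cover_contained : contained t s.
Proof. by apply/forallP => r; apply: cover_contained_row. Qed.

Lemma cover_size : sumn (pmap_core k s) = (sumn (pmap_core k t)).+1.
Proof.
pose n := size s + size t + (z + h) + (u + h).
rewrite (@sumn_nth _ n); last by rewrite size_map size_iota /n; lia.
rewrite (@sumn_nth (pmap_core k t) n); last by rewrite size_map size_iota /n; lia.
have zn : z + h <= n by rewrite /n; lia.
have un : u + h.-1 <= n by rewrite /n; lia.
have := sum_interval zn; have := sum_interval un.
suff : \sum_(i < n) mu i + \sum_(i < n) (u <= i < u + h.-1) =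
       \sum_(i < n) nth 0 (pmap_core k t) i + \sum_(i < n) (z <= i < z + h).
  by move: h0; lia.
rewrite -!big_split; apply: eq_bigr => i _; rewrite t_mu /cover_weight /= subnK //.
case zi: (z <= i < z + h) => //.
have := cover_mu_gt0 mu_noninc mu_k cd (i := i - z) ltac:(lia).
by rewrite -/(X q) -/z subnKC; lia.
Qed.

Lemma cover_strong : strong_cover t s k.
Proof. by rewrite /strong_cover s_core t_core cover_contained cover_size eqxx. Qed.

Lemma box_exists r b : b < row s r ->
  exists x : box s, x.1 = r :> nat /\ x.2 = b :> nat.
Proof.
move=> br; have rs : r < size s by rewrite -partition_gt0 //; lia.
have bh : b < head 0 s.
  by rewrite -nth0; have := @partition_noninc s 0 r s_part (leq0n r); lia.
by exists (Ordinal rs, Ordinal bh).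
Qed.

Definition block (j : nat) : {set box s} :=
  [set x in Defs.skew t s | X j <= x.1 < X j + h].

Lemma blockP j (x : box s) : reflect
  [/\ row t x.1 <= x.2, x.2 < row s x.1, X j <= x.1 & x.1 < X j + h] (x \in block j).
Proof. by rewrite !inE; apply: (iffP andP) =>
  [[/andP[? ?] /andP[? ?]]|[-> -> -> ->]]. Qed.

Lemma block_skew j (x : box s) : x \in block j -> x \in Defs.skew t s.
Proof. by rewrite inE => /andP[]. Qed.

Lemma skew_block (x : box s) : x \in Defs.skew t s ->
  exists2 j, j <= q & x \in block j.
Proof.
rewrite inE => xs; case: (boolP (in_block x.1)) =>
  [/in_blockP[j jq xj]|/cover_row_out tx].
  by exists j => //; rewrite !inE xs.
by move: xs; rewrite tx; lia.
Qed.

Lemma block_disjoint i j r : i <= q -> j <= q ->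
  X i <= r < X i + h -> X j <= r < X j + h -> i = j.
Proof.
wlog ij : i j / i <= j => [H iq jq ri rj|].
  by case: (leqP i j) => [/H|/ltnW /H H']; [exact | apply/esym/H'].
move=> iq jq ri rj; case: (ltngtP i j) ij => // ij _.
by have := sep iq; have := Xle ij; lia.
Qed.

(** Even for contiguous blocks, the last row of one ribbon and the first row of the next share no
    column. Contiguity forces [mu (X j) = k + 1 - h], whereas [cover_gap] makes [mu c] smaller. *)
Lemma block_gap j : j <= q -> X j.+1 = X j + h ->
  row s (X j.+1) <= row t (X j + h.-1).
Proof.
move=> jq Xj; have := cover_row_last jq.
have gap := cover_gap mu_noninc mu_k cd; rewrite -/(X q.+1) -/c in gap.
have := @partition_noninc s (c + h) (D c) s_part ltac:(lia).
have := core_rows s_core c; have := core_rows s_core (X j).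
have -> : D (X j) = X j.+1 by [].
have : X j.+1 = X j + k.+1 - mu (X j) by [].
have : D c = c + k.+1 - mu c by [].
have := mu_k c; have := mu_k (X j); lia.
Qed.

Lemma block_closed j (x x' : box s) : j <= q -> skew_edge t x x' -> x \in block j ->
  x' \in block j.
Proof.
move=> jq /and3P[xs /skew_block[j' jq' xj'] e] /blockP[tx xs' X1 X2].
have [tx' xs'' X1' X2'] := blockP _ _ xj'.
suff -> : j = j' by [].
have adj : x.1 = x'.1 :> nat \/
    x.2 = x'.2 :> nat /\ (x.1.+1 = x'.1 :> nat \/ x'.1.+1 = x.1 :> nat).
  case/orP: e => /andP[/eqP e12]; first by left; rewrite e12.
  by case/orP => /eqP e; right; rewrite e12; split=> //; [left | right].
case: (ltngtP j j') => // jj; exfalso.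
  have H1 := sep jq; have H2 := Xle jj.
  have := block_gap jq ltac:(lia).
  have -> : X j.+1 = x'.1 by lia.
  by have -> : X j + h.-1 = x.1; lia.
have H1 := sep jq'; have H2 := Xle jj.
have := block_gap jq' ltac:(lia).
have -> : X j'.+1 = x.1 by lia.
by have -> : X j' + h.-1 = x'.1; lia.
Qed.

Lemma skew_edge_sym : symmetric (skew_edge t (kappa := s)).
Proof.
move=> x x'; rewrite /skew_edge /edge_adjacent andbCA; congr (_ && (_ && _)).
by rewrite (eq_sym x.1) (eq_sym x.2) (orbC (x.2.+1 == x'.2)) (orbC (x.1.+1 == x'.1)).
Qed.

Lemma connect_block j (x x' : box s) : j <= q -> x \in block j ->
  connect (skew_edge t (kappa := s)) x x' = (x' \in block j).
Proof.
move=> jq xj; have csym := sym_connect_sym skew_edge_sym.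
apply/idP/idP => [/connectP[p]|x'j].
  elim: p x xj => [|x1 p IH] x xj /=; first by move=> _ ->.
  by move=> /andP[/block_closed e pp] lp; apply: (IH x1) => //; apply: e xj.
(* Every box is joined to the leftmost removed box [b] of the last row: go left while possible, then
   down. The box below is removed too, because in a block the next row of [s] is one longer than the
   current row of [t]. *)
have [b [b1 b2]] := box_exists (block_row_lt jq (ltac:(lia) : h.-1 < h)).
suff H (w : box s) : w \in block j -> connect (skew_edge t (kappa := s)) w b.
  by apply: connect_trans (H _ xj) _; rewrite csym; apply: H.
have [n] := ubnP (w.2 + (X j + h) - w.1).
elim: n w => // n IH w nw wj; have [tw ws X1 X2] := blockP _ _ wj.
case: (ltngtP (row t w.1) w.2) tw => // tw _.
  have [w' [w1 w2]] := box_exists (leq_ltn_trans (leq_pred _) ws).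
  have v1 : w'.2.+1 = w.2 :> nat by rewrite w2 (ltn_predK tw).
  have w'j : w' \in block j by apply/blockP; rewrite w1; split; lia.
  have wb : connect (skew_edge t (kappa := s)) w' b.
    by apply: IH w'j; rewrite w1; lia.
  apply: connect_trans wb; apply: connect1.
  apply/and3P; split; [exact: block_skew wj | exact: block_skew w'j |].
  by rewrite /edge_adjacent -val_eqE /= w1 eqxx v1 eqxx orbT.
case: (ltnP w.1.+1 (X j + h)) => wh.
  have := @cover_row_in j (w.1 - X j) jq ltac:(lia); rewrite subnKC // => tw1.
  have [w' [w1 w2]] := @box_exists w.1.+1 w.2 ltac:(lia).
  have tw' : row t w.1.+1 < row s w.1.+1.
    by have := @block_row_lt j (w.1.+1 - X j) jq ltac:(lia); rewrite subnKC //; lia.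
  have w'j : w' \in block j by apply/blockP; rewrite w1 w2; split; lia.
  have wb : connect (skew_edge t (kappa := s)) w' b.
    by apply: IH w'j; rewrite w1 w2; lia.
  apply: connect_trans wb; apply: connect1.
  apply/and3P; split; [exact: block_skew wj | exact: block_skew w'j |].
  by rewrite /edge_adjacent -!val_eqE /= w1 w2 !eqxx /= orbT.
have e1 : w.1 = X j + h.-1 :> nat by lia.
have -> : w = b; last exact: connect0.
rewrite [w]surjective_pairing [b]surjective_pairing.
by congr (_, _); apply: val_inj => /=; [rewrite b1 | rewrite b2 -tw e1].
Qed.

Lemma components_cover : components t s = [set block j | j : 'I_q.+1].
Proof.
apply/setP => C; apply/imsetP/imsetP => -[x].
  move=> /skew_block[j jq xj] ->; exists (Ordinal (jq : j < q.+1)) => //=.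
  by apply/setP => x'; rewrite inE (connect_block _ jq xj).
move=> _ ->; have jq : x <= q by rewrite -ltnS ltn_ord.
have [b [b1 b2]] := box_exists (block_row_lt jq h0).
have bj : b \in block x.
  by apply/blockP; rewrite b1 b2; split; have := block_row_lt jq h0; lia.
exists b; first exact: block_skew bj.
by apply/setP => x'; rewrite [RHS]inE (connect_block _ jq bj).
Qed.

Lemma block_row j i : j <= q -> i < h ->
  exists2 x : box s, x \in block j & x.1 = X j + i :> nat.
Proof.
move=> jq ih; have lt := block_row_lt jq ih; have [b [b1 b2]] := box_exists lt.
by exists b => //; apply/blockP; rewrite b1 b2; split; lia.
Qed.

Lemma block_inj : injective (fun j : 'I_q.+1 => block j).
Proof.
move=> i j ij; have iq : i <= q by rewrite -ltnS ltn_ord.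
have jq : j <= q by rewrite -ltnS ltn_ord.
have [x xi _] := block_row iq h0; have := xi; rewrite ij.
move: xi => /blockP[_ _ X1 X2] /blockP[_ _ X3 X4].
by apply: val_inj; apply: (@block_disjoint i j x.1) => //; lia.
Qed.

Lemma card_components : #|components t s| = q.+1.
Proof. by rewrite components_cover card_imset ?card_ord //; apply: block_inj. Qed.

Lemma height_block j : j <= q -> height (block j) = h.
Proof.
move=> jq; rewrite /height.
have -> : [set x.1 | x : box s in block j] = [set r :
  'I_(size s) | X j <= r < X j + h].
  apply/setP => r; rewrite inE; apply/imsetP/idP => [[x /blockP[_ _ X1 X2] ->]|rj].
    by rewrite X1.
  have [x xj xr] := @block_row j (r - X j) jq ltac:(lia).
  by exists x => //; apply: val_inj; rewrite /= xr subnKC; lia.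
by apply: card_interval; have := @block_size j h.-1 jq; lia.
Qed.

Lemma common_height_cover : common_height t s = h.
Proof.
rewrite /common_height components_cover; apply/eqP; rewrite eqn_leq; apply/andP;
  split.
  apply/bigmax_leqP => C /imsetP[j _ ->]; rewrite height_block //.
  by rewrite -ltnS ltn_ord.
rewrite -{1}(height_block (leq0n q)).
by apply: leq_bigmax_cond; apply/imsetP; exists ord0.
Qed.

Lemma top_row_block j r : j <= q -> top_row (block j) r = (r == (X j).+1).
Proof.
move=> jq; apply/andP/eqP => [[/exists_inP[x xj /eqP xr] /forall_inP H]|->].
  have [b bj b1] := block_row jq h0; have := H b bj.
  move: xj => /blockP[_ _ X1 X2]; rewrite -xr /row_of b1.
  by rewrite addn0; lia.
have [b bj b1] := block_row jq h0; split.
  by apply/exists_inP; exists b => //; rewrite /row_of b1 addn0.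
by apply/forall_inP => x /blockP[_ _ X1 X2]; rewrite /row_of ltnS.
Qed.

Lemma cover_markP r : is_mark t s r <-> exists2 j, j <= q & r = (X j).+1.
Proof.
rewrite /is_mark components_cover; split.
  move=> /exists_inP[C /imsetP[j _ ->]].
  have jq : j <= q by rewrite -ltnS ltn_ord.
  by rewrite top_row_block // => /eqP ->; exists j.
move=> [j jq ->]; apply/exists_inP; exists (block j); last by rewrite top_row_block.
by apply/imsetP; exists (Ordinal (jq : j < q.+1)).
Qed.

(** The components below the marked one are the blocks [j + 1, ..., q]. *)
Lemma spin_cover_block j : j <= q ->
  spin_cover t s (X j).+1 = q.+1 * h.-1 + (q - j).
Proof.
move=> jq; rewrite /spin_cover card_components common_height_cover subn1;
  congr (_ + _).
have -> : [set C in components t s | [forall x in C, (X j).+1 < row_of x]] =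
    [set block i | i : 'I_q.+1 in [set i : 'I_q.+1 | j.+1 <= i < j.+1 + (q - j)]].
  apply/setP => C; rewrite inE components_cover; apply/andP/imsetP.
    move=> [/imsetP[i _ ->] /forall_inP H]; exists i => //; rewrite inE.
    have iq : i <= q by rewrite -ltnS ltn_ord.
    have [b bi b1] := block_row iq h0; have := H b bi; rewrite /row_of b1 addn0.
    by case: (leqP i j) => ij; [have := Xle ij; lia | lia].
  move=> [i]; rewrite inE => ij ->; split; first exact: imset_f.
  have iq : i <= q by rewrite -ltnS ltn_ord.
  apply/forall_inP => x /blockP[_ _ X1 X2]; rewrite /row_of.
  have ji : j.+1 <= i by lia.
  by have := Xle ji; have := sep jq; lia.
rewrite card_imset; last exact: block_inj.
by apply: card_interval; lia.
Qed.
End Cover.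

(** * Every strong cover comes from a cover datum *)

Section Beads.
Local Open Scope nat_scope.
Local Notation row s i := (nth 0 s i).

Definition bead (s : seq nat) (i : nat) : int := ((row s i)%:Z - i%:Z)%R.

(* The number of beads that are at least [p]. *)
Definition nbeads (s : seq nat) (p : int) : nat :=
  find (fun i => bead s i < p)%R (iota 0 (size s + `|p|.+2)).

Definition beaded (s : seq nat) (p : int) : bool := nbeads s (p + 1)%R < nbeads s p.

Lemma bead_lt s i j : is_partition s -> i < j -> (bead s j < bead s i)%R.
Proof. by move=> sP ij; have := partition_noninc sP (ltnW ij); rewrite /bead;
  lia. Qed.

Lemma nbeadsP s i p : is_partition s -> (i < nbeads s p) = (p <= bead s i)%R.
Proof.
move=> sP; rewrite /nbeads.
set P := (fun i => _); set r := iota _ _.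
have hs : has P r.
  apply/(hasP); exists (size s + `|p|.+1); first by rewrite mem_iota; lia.
  by rewrite /P /bead nth_default /=; lia.
have fr : find P r < size s + `|p|.+2 by rewrite -[X in _ < X](size_iota 0)
  -has_find.
have Pf : P (find P r) by have := nth_find 0 hs; rewrite nth_iota.
case: (ltnP i (find P r)) => ir.
  have := before_find 0 ir; rewrite nth_iota; last by lia.
  by rewrite add0n /P /=; lia.
have : (bead s i <= bead s (find P r))%R.
  move: ir; rewrite leq_eqVlt => /orP[/eqP <- //|ir]; apply/ltW/bead_lt => //.
by move: Pf; rewrite /P /=; lia.
Qed.

Section Partition.
Variable s : seq nat.
Hypothesis sP : is_partition s.
Local Notation N := (nbeads s).
Local Notation B := (beaded s).

Lemma nbeads_step p : N p = N (p + 1)%R + B p.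
Proof.
rewrite /beaded; have := nbeadsP (N (p + 1)%R) (p + 1)%R sP.
have := nbeadsP (N (p + 1)%R) p sP; have := nbeadsP (N (p + 1)%R).+1 p sP.
have := bead_lt sP (ltnSn (N (p + 1)%R)).
have := nbeadsP (N p) p sP; have := nbeadsP (N p) (p + 1)%R sP.
by rewrite !ltnn; lia.
Qed.

Lemma beaded_bead p : B p -> bead s (N (p + 1)%R) = p.
Proof.
rewrite /beaded => Bp; have := nbeadsP (N (p + 1)%R) (p + 1)%R sP.
by have := nbeadsP (N (p + 1)%R) p sP; rewrite Bp ltnn; lia.
Qed.

Lemma nbeads_bead i : N (bead s i + 1)%R = i /\ B (bead s i).
Proof.
have H : N (bead s i + 1)%R = i.
  have := nbeadsP i (bead s i + 1)%R sP; have := nbeadsP i.-1 (bead s i + 1)%R sP.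
  case: (posnP i) => i0; first by rewrite i0; lia.
  by have := bead_lt sP (ltac:(lia) : i.-1 < i); lia.
split=> //; rewrite /beaded H; by rewrite nbeadsP.
Qed.

Lemma nbeads_large p : ((row s 0)%:Z < p)%R -> N p = 0.
Proof. by have := nbeadsP 0 p sP; rewrite /bead; lia. Qed.

Lemma nbeads_small p : (p <= - (size s)%:Z)%R -> (N p)%:Z = (1 - p)%R.
Proof.
move=> ps; have := nbeadsP (`|p|) p sP; have := nbeadsP (`|p|.+1) p sP.
by rewrite /bead !nth_default; lia.
Qed.
End Partition.

Section CoreBeads.
Variables (k : nat) (s : seq nat).
Hypothesis s_core : is_core k s.
Local Notation n := k.+1.
Local Notation mu := (nth 0 (pmap_core k s)).
Local Notation D := (row_start k mu).
Let sP : is_partition s. Proof. by case/andP: s_core. Qed.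
Local Notation N := (nbeads s).
Local Notation B := (beaded s).

Lemma bead_row_start i : bead s (D i) = (bead s i - n%:Z)%R.
Proof.
rewrite /bead (core_rows s_core i); have := core_mu_le s_core i.
have : D i = i + k.+1 - mu i by [].
lia.
Qed.

Lemma row_startE p : B p -> D (N (p + 1)%R) = N (p - n%:Z + 1)%R.
Proof.
move=> Bp; have := bead_row_start (N (p + 1)%R); rewrite (beaded_bead sP) // => <-.
by have [] := nbeads_bead sP (D (N (p + 1)%R)).
Qed.

Lemma beaded_down p : B p -> B (p - n%:Z)%R.
Proof.
move=> Bp; have := bead_row_start (N (p + 1)%R); rewrite (beaded_bead sP) // => <-.
by have [] := nbeads_bead sP (D (N (p + 1)%R)).
Qed.

Lemma beaded_down_iter p j j' : j <= j' -> B (p - (j * n)%N%:Z)%R ->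
  B (p - (j' * n)%N%:Z)%R.
Proof.
elim: j' => [|j' IH]; first by rewrite leqn0 => /eqP ->.
rewrite leq_eqVlt => /orP[/eqP -> //|]; rewrite ltnS => jj /(IH jj) /beaded_down.
by congr (B _); lia.
Qed.

End CoreBeads.
End Beads.


(** Written additively, this compares windows of [e] positions: the one below [p] holds at most as
    many beads of [s] as the one below [p'] holds of [s']. *)
Lemma nbeads_interval (s s' : seq nat) (p p' : int) (e : nat) :
  is_partition s -> is_partition s' ->
  (forall i, (0 < i <= e)%N -> beaded s (p - i%:Z) -> beaded s' (p' - i%:Z)) ->
  (nbeads s (p - e%:Z) + nbeads s' p' <= nbeads s' (p' - e%:Z) + nbeads s p)%N.
Proof.
move=> sP s'P; elim: e => [|e IH] H; first by rewrite !subr0 addnC.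
have := IH (fun i ie => H i ltac:(lia)); move: (H e.+1 ltac:(lia)).
have := nbeads_step sP (p - e.+1%:Z); have := nbeads_step s'P (p' - e.+1%:Z).
have -> : p - e.+1%:Z + 1 = p - e%:Z by lia.
have -> : p' - e.+1%:Z + 1 = p' - e%:Z by lia.
by case: (beaded s _) => e1 e2; [move=> /(_ isT) e3 | move=> _]; lia.
Qed.

(** * Choosing the beads to be moved down *)

Section Descend.
Local Open Scope nat_scope.
Variables (k : nat) (s t : seq nat).
Hypothesis s_core : is_core k s.
Hypothesis t_core : is_core k t.
Hypothesis ts_le : forall i, nth 0 t i <= nth 0 s i.
Local Notation n := k.+1.
Local Notation row s i := (nth 0 s i).
Local Notation mu := (nth 0 (pmap_core k s)).
Local Notation D := (row_start k mu).
Local Notation N := (nbeads s).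
Local Notation M := (nbeads t).
Local Notation B := (beaded s).
Let sP : is_partition s. Proof. by case/andP: s_core. Qed.
Let tP : is_partition t. Proof. by case/andP: t_core. Qed.

Lemma nbeads_le p : M p <= N p.
Proof.
case: (posnP (M p)) => [-> //|M0].
have := nbeadsP (M p).-1 p tP; have := nbeadsP (M p).-1 p sP.
by have := ts_le (M p).-1; rewrite /bead; lia.
Qed.

(* [p] is the last bead of its residue class modulo [n], and [s] has more beads than
   [t] from [p] on. *)
Definition movable (p : int) : bool := [&& B p, ~~ B (p + n%:Z)%R & M p < N p].

(** The highest position with a surplus of [s] works. Above it both bead sets agree, so a bead of
    [s] one period higher would belong to [t]; the core [t] would then have a bead here too, and
    there would be no surplus. *)
Lemma movable_exists : t <> s -> exists p, movable p.
Proof.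
move=> ts; have [i ti] : exists i, row t i < row s i.
  apply: contra_notP ts => /forallNP H; apply: partition_ext => // i.
  by apply/eqP; rewrite eqn_leq ts_le leqNgt; apply/negP/H.
pose P e := M (bead s i + e%:Z)%R < N (bead s i + e%:Z)%R.
have P0 : exists e, P e.
  exists 0; rewrite /P addr0; have := nbeadsP i (bead s i) sP.
  by have := nbeadsP i (bead s i) tP; rewrite /bead; lia.
have Pmax e : P e -> e <= i + row s 0.
  rewrite /P leqNgt => Pe; apply/negP => ei; move: Pe.
  by rewrite (nbeads_large sP) // /bead; lia.
case: (ex_maxnP P0 Pmax) => e Pe emax; exists (bead s i + e%:Z)%R.
have Nz f : e < f -> N (bead s i + f%:Z)%R = M (bead s i + f%:Z)%R.
  move=> ef; apply/eqP; rewrite eqn_leq nbeads_le andbT leqNgt.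
  by apply/negP => /emax; lia.
have E f : (bead s i + f%:Z + 1 = bead s i + f.+1%:Z)%R by lia.
have F : (bead s i + e%:Z + n%:Z = bead s i + (e + n)%N%:Z)%R by lia.
rewrite /movable -/(P e) Pe andbT F.
have := nbeads_step sP (bead s i + e%:Z)%R;
  have := nbeads_step tP (bead s i + e%:Z)%R.
rewrite !E (Nz e.+1) //.
have := nbeads_step sP (bead s i + (e + n)%N%:Z)%R.
have := nbeads_step tP (bead s i + (e + n)%N%:Z)%R.
rewrite !E (Nz (e + n).+1) ?(Nz (e + n)); try lia.
have := @beaded_down k t t_core (bead s i + (e + n)%N%:Z)%R.
rewrite (_ : (bead s i + (e + n)%N%:Z - n%:Z = bead s i + e%:Z)%R); last by lia.
by move: Pe; rewrite /P; lia.
Qed.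

Definition least_movable (S : int) : Prop :=
  movable S /\ forall p, movable p -> (S <= p)%R.

Lemma movable_min : t <> s -> exists S, least_movable S.
Proof.
move=> /movable_exists [p0 mp0].
pose b : int := (- (size s + size t + 1)%N%:Z)%R.
have low p : movable p -> (b < p)%R.
  move=> /and3P[_ _]; case: (ltP b p) => // pb.
  have := nbeads_small sP (_ : p <= - (size s)%:Z)%R;
    have := nbeads_small tP (_ : p <= - (size t)%:Z)%R.
  by rewrite /b in pb => /(_ ltac:(lia)) + /(_ ltac:(lia)); lia.
have ex : exists e : nat, movable (b + e%:Z)%R.
  exists (`|(p0 - b)%R|%N); have := low _ mp0 => bp.
  by rewrite (_ : (b + `|(p0 - b)%R|%N%:Z)%R = p0) //; lia.
case: (ex_minnP ex) => e me emin; exists (b + e%:Z)%R; split=> // p mp.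
have bp := low _ mp.
have := emin `|(p - b)%R|%N; rewrite (_ : (b + `|(p - b)%R|%N%:Z)%R = p);
  last by lia.
by move=> /(_ mp); lia.
Qed.

Variable S : int.
Hypothesis S_least : least_movable S.

(* The position [e] places below [S], shifted down by [j] periods. *)
Local Notation at_ e j := (S - e%:Z - (j * n)%N%:Z)%R.

Let down e j j' : j <= j' -> B (at_ e j) -> B (at_ e j').
Proof. exact: beaded_down_iter. Qed.

Let downM e j j' : j <= j' -> beaded t (at_ e j) -> beaded t (at_ e j').
Proof. exact: beaded_down_iter. Qed.

Lemma bead_S j : B (at_ 0 j).
Proof.
by apply: (@down 0 0) => //; case: S_least => /and3P[BS _ _] _; rewrite mul0n !subr0.
Qed.

Definition critical_level (J : nat) : Prop :=
  [/\ 0 < J, N (at_ 0 J) = M (at_ 0 J) & forall j, j < J ->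
    M (at_ 0 j) < N (at_ 0 j)].

Lemma level_exists : exists J, critical_level J.
Proof.
have ex : exists J, N (at_ 0 J) == M (at_ 0 J).
  exists (`|S| + size s + size t).
  set p := (X in nbeads s X == _).
  have := leq_pmulr (`|S| + size s + size t) (ltn0Sn k) => le.
  have ps : (p <= - (size s)%:Z)%R by rewrite /p; lia.
  have pt : (p <= - (size t)%:Z)%R by rewrite /p; lia.
  by rewrite -/p; have := nbeads_small sP ps; have := nbeads_small tP pt; lia.
case: (ex_minnP ex) => J /eqP JE Jmin; exists J; split=> //.
  rewrite lt0n; apply/eqP => J0; move: JE; rewrite J0 mul0n !subr0.
  by case: S_least => /and3P[_ _ +] _; lia.
move=> j jJ; rewrite ltn_neqAle nbeads_le andbT eq_sym.
by apply/negP => /Jmin; lia.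
Qed.

Variable J : nat.
Hypothesis J_crit : critical_level J.

Let compareM j j' e : j <= j' ->
  M (at_ e j) + M (at_ 0 j') <= M (at_ e j') + M (at_ 0 j).
Proof.
move=> jj; have := @nbeads_interval t t (at_ 0 j) (at_ 0 j') e tP tP.
have E i j0 : (at_ 0 j0 - i%:Z = at_ i j0)%R by lia.
rewrite !E; apply => i _; rewrite !E; exact: downM.
Qed.

(** Otherwise the [k] positions below [S - J n] hold no more beads of [s] than those below
    [S - (J - 1) n], while for [t] the comparison goes the other way. The surplus at level [J - 1]
    would last until one place above [S - J n], and as [s] has a bead there, up to level [J]. *)
Lemma gap_exists : exists2 e, 0 < e < n & ~~ B (at_ e 0) && B (at_ e J).
Proof.
have [J_gt0 J_eq J_lt] := J_crit; apply: contrapT => H.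
have H' e : 0 < e <= k -> B (at_ e J) -> B (at_ e J.-1).
  move=> ek BJ; apply: (@down e 0 J.-1) => //; apply: contrapT => nB.
  by apply: H; exists e; [lia | rewrite BJ andbT; apply/negP].
have E i j0 : (at_ 0 j0 - i%:Z = at_ i j0)%R by lia.
have := @nbeads_interval s s (at_ 0 J) (at_ 0 J.-1) k sP sP; rewrite !E => cs.
have {}cs := cs (fun i ik => ltac:(rewrite !E; exact: H')).
have cm := @compareM J.-1 J k (leq_pred J).
have e1 : (at_ k J.-1 = at_ 0 J + 1)%R by have := mulSn J.-1 n;
  rewrite (prednK J_gt0); lia.
have := nbeads_step sP (at_ 0 J); have := nbeads_step tP (at_ 0 J).
rewrite bead_S -e1; have := nbeads_le (at_ k J.-1); have := nbeads_le (at_ k J).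
have := @J_lt J.-1 ltac:(lia); move: J_eq cs cm; lia.
Qed.

Variable e : nat.
Hypothesis e_int : 0 < e < n.
Hypothesis e_min : forall e', 0 < e' < e -> B (at_ e' 0) \/ ~~ B (at_ e' J).

Lemma column_level e' j : 0 < e' < e -> j <= J -> B (at_ e' j) = B (at_ e' 0).
Proof.
move=> ee jJ; apply/idP/idP => H; last exact: down H.
by case: (e_min ee) => // /negP[]; apply: down H.
Qed.

(** From [S - j n] down to [S - e' - j n], [s] has as many beads as at level [J] by [column_level],
    and [t] at most as many as at level [J]. There [t] gains no more than [s], the counts being
    equal at the start. So the surplus at [S - j n] survives. *)
Lemma surplus e' j : e' < e -> j < J -> M (at_ e' j) < N (at_ e' j).
Proof.
have [_ J_eq J_lt] := J_crit.
move=> ee jJ; rewrite ltnNge; apply/negP => le.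
have E i j0 : (at_ 0 j0 - i%:Z = at_ i j0)%R by lia.
have := @nbeads_interval s s (at_ 0 J) (at_ 0 j) e' sP sP; rewrite !E => cs.
have {}cs : N (at_ e' J) + N (at_ 0 j) <= N (at_ e' j) + N (at_ 0 J).
  by apply: cs => i ie; rewrite !E !column_level //; lia.
have := @compareM j J e' (ltnW jJ); have := J_lt j jJ; have := nbeads_le (at_ e' J).
by move: J_eq; lia.
Qed.

(** A bead without one above it on its runner would be movable by [surplus], against the minimality
    of [S]. *)
Lemma column_up e' : 0 < e' < e -> B (at_ e' 0) = B (at_ e' 0 + n%:Z)%R.
Proof.
move=> ee; apply/idP/idP => H; last first.
  by have := beaded_down s_core H; rewrite addrK.
case/boolP: (B _) => // nB.
have [J_gt0 _ _] := J_crit.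
have : movable (at_ e' 0) by rewrite /movable H nB surplus //; lia.
by case: S_least => _ S_min /S_min; lia.
Qed.

Variable Q : nat.
(** The beads [S - j n] with [j < Q] have a vacant place [e] positions below; they are the ones to
    be moved, one component each. *)
Definition first_level : Prop :=
  B (at_ e Q) /\ forall j, j < Q -> ~~ B (at_ e j).
Hypothesis Q_int : 0 < Q <= J.
Hypothesis Q_first : first_level.

(** The datum read off the abacus: [y] is the row of the bead [S], [h] counts the beads at
    [S - e + 1, ..., S], and [u] is the first row whose bead is below [S + n]. *)
Let y := N (S + 1)%R.
Let X j := iter j D y.
Let h := N (at_ e 0 + 1)%R - y.
Let u := N (S + n%:Z)%R.
Let q := Q.-1.

Lemma nbeads_mono p p' : (p <= p')%R -> N p' <= N p.
Proof.
move=> pp; case: (posnP (N p')) => [-> //|p0].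
have := nbeadsP (N p').-1 p sP; have := nbeadsP (N p').-1 p' sP.
by lia.
Qed.

Lemma X_row j : X j = N (at_ 0 j + 1)%R.
Proof.
elim: j => [|j IH]; first by rewrite mul0n !subr0.
have -> : X j.+1 = D (X j) by [].
by rewrite IH (row_startE s_core (bead_S j)); congr nbeads; lia.
Qed.

Lemma column_rows e' j : e' <= e -> j <= J ->
  N (at_ e' j + 1)%R + y = X j + N (at_ e' 0 + 1)%R.
Proof.
move=> ee jJ; elim: e' ee => [|e' IH] ee.
  by rewrite X_row mul0n !subr0 addnC.
have E j0 : (at_ e'.+1 j0 + 1 = at_ e' j0)%R by lia.
rewrite !E (nbeads_step sP (at_ e' j)) (nbeads_step sP (at_ e' 0)).
have -> : B (at_ e' j) = B (at_ e' 0).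
  case: (posnP e') => [->|e0]; last by apply: column_level => //; lia.
  by rewrite !bead_S.
by have := IH (ltnW ee); lia.
Qed.

Lemma h_gt0 : 0 < h.
Proof.
have le : (at_ e 0 + 1 <= S)%R by lia.
have BS : B S by have := bead_S 0; rewrite mul0n !subr0.
by have := nbeads_mono le; have := nbeads_step sP S; rewrite BS /h /y; lia.
Qed.

Lemma column_h j : j <= J -> N (at_ e j + 1)%R = X j + h.
Proof. by move=> jJ; have := column_rows (leqnn e) jJ; have := h_gt0; rewrite /h;
  lia. Qed.

Lemma column_of j i : j <= J -> i < h -> exists e',
  [/\ e' < e, bead s (X j + i) = at_ e' j, N (at_ e' j + 1)%R = X j + i
    & B (at_ e' j)].
Proof.
move=> jJ ih; have [E1 E2] := nbeads_bead sP (X j + i).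
have := nbeadsP (X j + i) (at_ e j + 1)%R sP.
have := nbeadsP (X j + i) (at_ 0 j + 1)%R sP.
rewrite column_h // -X_row ltn_add2l ih => H1 H2.
have pE : bead s (X j + i) = at_ (absz (at_ 0 j - bead s (X j + i))%R) j by lia.
exists (absz (at_ 0 j - bead s (X j + i))%R); rewrite -pE; split=> //.
by lia.
Qed.

(** By [column_up] the beads just below [S + n] repeat those just below [S], so the rows from [u]
    run parallel to those from [y + 1]. *)
Lemma rows_above e' : 0 < e' <= e ->
  N (at_ e' 0 + n%:Z + 1)%R + y.+1 = u + N (at_ e' 0 + 1)%R.
Proof.
have y1 : N S = y.+1.
  by rewrite nbeads_step // (_ : B S) ?addn1 //; have := bead_S 0;
    rewrite mul0n !subr0.
elim: e' => // e' IH ee.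
case: (posnP e') => [->|e0].
  have -> : (at_ 1 0 + n%:Z + 1 = S + n%:Z)%R by lia.
  by rewrite (_ : (at_ 1 0 + 1 = S)%R) ?y1 //; lia.
have -> : (at_ e'.+1 0 + n%:Z + 1 = at_ e' 0 + n%:Z)%R by lia.
have -> : (at_ e'.+1 0 + 1 = at_ e' 0)%R by lia.
rewrite (nbeads_step sP (at_ e' 0)) (nbeads_step sP (at_ e' 0 + n%:Z)%R).
by rewrite -column_up; [have := IH ltac:(lia); lia | lia].
Qed.

Lemma descend_cover : cover_data D y q h u.
Proof.
have [Q_bead Q_min] := Q_first.
have y1 : bead s y = S.
  by apply: beaded_bead => //; have := bead_S 0; rewrite mul0n !subr0.
have qQ : q.+1 = Q by rewrite /q; lia.
split.
- exact: h_gt0.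
- move=> a Da; case: S_least => /and3P[_ /negP + _] _; apply.
  have := bead_row_start s_core a; rewrite Da y1 => ->; rewrite subrK.
  by have [] := nbeads_bead sP a.
- move=> j i jq ih; have [e' [ee pE rE Be]] := @column_of j i ltac:(lia) ih.
  rewrite -/(X j) -/(X j.+1) -rE row_startE //.
  have -> : (at_ e' j - n%:Z + 1 = at_ e' j.+1 + 1)%R by lia.
  have := @column_rows e' j.+1 (ltnW ee) ltac:(lia).
  have := @column_rows e' j (ltnW ee) ltac:(lia).
  by rewrite rE; lia.
(* If the run continued, the bead of row [X q + h] would be at [S - e - q n], which is vacant
   because [q < Q]. *)
- rewrite -/(X q) -/(X q.+1) => Dq.
  have := bead_row_start s_core (X q + h); rewrite Dq qQ -column_h; last by lia.
  rewrite beaded_bead // => e1.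
  have [_ Bq] := nbeads_bead sP (X q + h).
  have := nbeadsP (X q + h) (at_ e q + 1)%R sP; rewrite column_h ?ltnn; last by lia.
  have := @Q_min q ltac:(lia).
  have -> : at_ e q = bead s (X q + h).
    by move: e1; rewrite -qQ; lia.
  by rewrite Bq.
- rewrite -/(X q) -/(X q.+1) qQ -column_h; last by lia.
  by rewrite X_row; apply: nbeads_mono; rewrite -qQ; lia.
- move=> i ih; have [e' [ee pE rE Be]] := @column_of 0 i.+1 (leq0n J) ih.
  have e0 : 0 < e'.
    rewrite lt0n; apply/eqP => e0; move: rE; rewrite e0 mul0n !subr0 -/y /X /=; lia.
  have := @rows_above e' ltac:(lia); rewrite rE /X /= => e1.
  have -> : u + i = N (at_ e' 0 + n%:Z + 1)%R by lia.
  rewrite row_startE //; last by rewrite -column_up //; lia.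
  by rewrite addrK rE.
Qed.

(** In a block each bead of [t'] sits where [s] has its next one, and the last bead of [t'] fills
    the vacant place. By [surplus] just above that position, [t] has at most [i] beads higher up, so
    its bead in row [i] is no higher. *)
Lemma descend_le t' : is_core k t' ->
  (forall i, nth 0 (pmap_core k t') i = cover_weight mu (X q) h u i) ->
  forall i, row t i <= row t' i.
Proof.
have [Q_bead _] := Q_first.
move=> t'C t'E i; have cd := descend_cover.
have qQ : q.+1 = Q by rewrite /q; lia.
have tb p r : M p <= r -> (bead t r < p)%R.
  by move=> Mr; have := nbeadsP r p tP; lia.
case: (boolP (in_block k s y q h i)) => [/in_blockP[j jq ij]|out]; last first.
  by rewrite (cover_row_out s_core t'C cd t'E out).
rewrite -/(X j) in ij.
have iE : i = X j + (i - X j) by lia.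
case: (ltnP (i - X j).+1 h) => ih.
  have := cover_row_in s_core t'C cd t'E jq ih; rewrite -/(X j) -iE.
  have iE1 : X j + (i - X j).+1 = i.+1 by lia.
  have [e' [ee pE rE Be]] := @column_of j (i - X j).+1 ltac:(lia) ih.
  have e0 : 0 < e'.
    rewrite lt0n; apply/eqP => e0; have := X_row j; rewrite -[in X in _ = X]e0 rE.
    by lia.
  have := @surplus e'.-1 j ltac:(lia) ltac:(lia).
  have -> : (at_ e'.-1 j = at_ e' j + 1)%R by lia.
  rewrite rE => lt; have := tb (at_ e' j + 1)%R i ltac:(lia).
  by move: pE; rewrite iE1 /bead; lia.
have ihE : i = X j + h.-1 by have := h_gt0; lia.
have := cover_row_last s_core t'C cd t'E jq; rewrite -/(X j) -/(X q.+1) -ihE qQ.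
have := @surplus e.-1 j ltac:(lia) ltac:(lia).
have -> : (at_ e.-1 j = at_ e j + 1)%R by lia.
rewrite column_h; last by lia.
move=> lt; have := tb (at_ e j + 1)%R i ltac:(lia).
have : bead s (X j) = at_ 0 j by rewrite X_row beaded_bead // bead_S.
have : bead s (X Q) = at_ 0 Q by rewrite X_row beaded_bead // bead_S.
have : bead s (X Q + h) = at_ e Q by rewrite -column_h ?beaded_bead //; lia.
by rewrite /bead; have := h_gt0; lia.
Qed.
End Descend.

Section StrongCovers.
Local Open Scope nat_scope.
Variable k : nat.
Local Notation row s i := (nth 0 s i).
Local Notation weight s := (nth 0 (pmap_core k s)).

(* Let [S] be the least movable position, [J] the first level at which [s] and [t]
   have equally many beads from [S - J n] on, and [e > 0] least such that [S - e] is
   a gap of [s] but [S - e - J n] is a bead. Counting beads one period apart shows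
   that [s] has strictly more beads than [t] from any of the positions
   [S - e' - j n], [e' < e], [j < J], so that the beads [S - j n] can be moved down
   by [e] without leaving the cores containing [t]. *)
Lemma exists_cover (s t : seq nat) : is_core k s -> is_core k t ->
  (forall i, row t i <= row s i) -> t <> s ->
  exists y q h u, cover_data (row_start k (weight s)) y q h u /\
    forall t', is_core k t' ->
      (forall i, weight t' i = cover_weight (weight s) (iter q (row_start k
        (weight s)) y) h u i) ->
      forall i, row t i <= row t' i.
Proof.
move=> sC tC ts ne; have [S Smin] := movable_min sC tC ts ne.
have [J Jc] := level_exists sC tC ts Smin.
have [e0 e0n e0P] := gap_exists sC tC ts Smin Jc.
have [e [en e1 e2 emin]] : exists e, [/\ 0 < e < k.+1,
    ~~ beaded s (S - e%:Z - (0 * k.+1)%N%:Z), beaded s (S - e%:Z - (J * k.+1)%N%:Z)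
    & forall e', 0 < e' < e -> beaded s (S - e'%:Z - (0 * k.+1)%N%:Z) \/
                           ~~ beaded s (S - e'%:Z - (J * k.+1)%N%:Z)].
  pose P e := (0 < e < k.+1) && (~~ beaded s (S - e%:Z - (0 * k.+1)%N%:Z) &&
     beaded s (S - e%:Z - (J * k.+1)%N%:Z)).
  have ex : exists e, P e by exists e0; rewrite /P e0n.
  case: (ex_minnP ex) => e /and3P[en e1 e2] emin; exists e; split=> // e' ee.
  case: (boolP (beaded s (S - e'%:Z - (0 * k.+1)%N%:Z))) => [|nB]; [by left | right].
  by apply/negP => BJ; have := emin e'; rewrite /P nB BJ; lia.
have ex : exists Q, beaded s (S - e%:Z - (Q * k.+1)%N%:Z) by exists J.
case: (ex_minnP ex) => Q BQ Qmin.
have QJ : 0 < Q <= J.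
  by rewrite Qmin // andbT lt0n; apply/eqP => Q0; move/negP: e1; rewrite -Q0.
have Qmin' j : j < Q -> ~~ beaded s (S - e%:Z - (j * k.+1)%N%:Z).
  by move=> jQ; apply/negP => /Qmin; lia.
do 4 eexists; split.
  exact: (descend_cover sC tC ts Smin Jc en emin QJ (conj BQ Qmin')).
exact: (descend_le sC tC ts Smin Jc en emin QJ (conj BQ Qmin')).
Qed.

Lemma cover_core (s : seq nat) y q h u : is_core k s ->
  cover_data (row_start k (weight s)) y q h u ->
  exists2 t, is_core k t & forall i,
    weight t i = cover_weight (weight s) (iter q (row_start k (weight s)) y) h u i.
Proof.
move=> sC cd.
have noninc := core_mu_noninc sC; have le := core_mu_le sC.
have mu0 i : size s <= i -> weight s i = 0.
  by move=> si; rewrite nth_default // size_map size_iota.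
have [t [tC tE]] := @core_exists k (size s) _ (cover_weight_noninc noninc le cd)
  (cover_weight_le noninc le cd)
  (fun i => cover_weight_zero noninc le cd mu0).
by exists t.
Qed.

(** Iterating [exists_cover] leads from [s] down to [t] in steps of size one. *)
Lemma core_size_lt (s t : seq nat) : is_core k s -> is_core k t ->
  (forall i, row t i <= row s i) -> t <> s ->
  sumn (pmap_core k t) < sumn (pmap_core k s).
Proof.
have [n] := ubnP (sumn (pmap_core k s)); elim: n s => // n IH s sn sC tC ts ne.
have [y [q [h [u [cd H]]]]] := exists_cover sC tC ts ne.
have [t' t'C t'E] := cover_core sC cd.
have t's := cover_size sC t'C cd t'E.
case: (t =P t') => [->|ne']; first by rewrite t's.
have := IH t' ltac:(lia) t'C tC (H t' t'C t'E) ne'.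
by lia.
Qed.

(** [exists_cover] puts a core [t'] of the required form between [t] and [s]. It has the same size
    as [t], so [core_size_lt] leaves only equality. *)
Lemma strong_coverP (s t : seq nat) : is_core k s -> strong_cover t s k <->
  exists y q h u, [/\ is_core k t, cover_data (row_start k (weight s)) y q h u &
    forall i, weight t i = cover_weight (weight s) (iter q (row_start k (weight
      s)) y) h u i].
Proof.
move=> sC; split; last first.
  by move=> [y [q [h [u [tC cd tE]]]]]; apply: (cover_strong sC tC cd tE).
move=> /and4P[tC _ /forallP ts /eqP sz].
have ts' i : row t i <= row s i.
  case: (ltnP i (maxn (size t) (size s))) => im; first exact: (ts (Ordinal im)).
  by rewrite nth_default //; lia.
have ne : t <> s by move=> e; rewrite e in sz; lia.
have [y [q [h [u [cd H]]]]] := exists_cover sC tC ts' ne.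
have [t' t'C t'E] := cover_core sC cd.
have t's := cover_size sC t'C cd t'E.
exists y, q, h, u; split=> // i; rewrite -t'E.
case: (t =P t') => [-> //|ne'].
by have := core_size_lt t'C tC (H t' t'C t'E) ne'; lia.
Qed.
End StrongCovers.

(** * Summation over chains of strong covers *)

Section CoverUniqueness.
Local Open Scope nat_scope.
Variables (k : nat) (s : seq nat).
Hypothesis s_core : is_core k s.
Local Notation mu := (nth 0 (pmap_core k s)).
Local Notation D := (row_start k mu).
Let noninc := core_mu_noninc s_core.
Let mu_k := core_mu_le s_core.
Let D_mono := increasing_mono (row_start_lt noninc mu_k).
Let D_gt := row_start_gt mu_k.

Lemma row_start_inj : injective D.
Proof.
by move=> a b ab; have := D_mono a b; have := D_mono b a; rewrite ab; lia.
Qed.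

Lemma bounce_top x : exists y q, (forall a, D a <> y) /\ iter q D y = x.
Proof.
have [n] := ubnP x; elim: n x => // n IH x xn.
have [[a ax]|nx] := pselect (exists a, D a = x); last first.
  by exists x, 0; split=> // a ax; apply: nx; exists a.
have [y [q [top qa]]] := IH a ltac:(have := D_gt a; lia).
by exists y, q.+1; split=> //=; rewrite qa.
Qed.

Lemma bounce_top_unique y y' q q' : (forall a, D a <> y) -> (forall a, D a <> y') ->
  iter q D y = iter q' D y' -> y = y' /\ q = q'.
Proof.
move=> top top'; elim: q q' => [|q IH] [|q'] //=.
- by move=> /esym /top.
- by move=> /top'.
- by move=> /row_start_inj /IH [-> ->].
Qed.

Lemma cover_data_unique y q h h' u u' : cover_data D y q h u ->
  cover_data D y q h' u' -> h = h' /\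
  forall i, cover_weight mu (iter q D y) h u i = cover_weight mu (iter q D y) h'
    u' i.
Proof.
move=> cd cd'; have hh : h = h'.
  case: (ltngtP h h') => // hh.
    by case: (cover_stop cd); apply: (cover_run cd').
  by case: (cover_stop cd'); apply: (cover_run cd).
rewrite -hh in cd' *; split=> // i; rewrite /cover_weight.
case: (ltnP 1 h) => h1; last by rewrite (_ : h.-1 = 0) ?addn0; lia.
have := cover_above cd (i := 0) h1; have := cover_above cd' (i := 0) h1.
by rewrite !addn0 => <- /row_start_inj ->.
Qed.

(** For [q < q'] only the first weight is lowered in row [iter q D y]: the lowered rows of the
    second come later and its raised rows lie above [y]. *)
Lemma cover_weight_bottom y q q' h h' u u' : cover_data D y q h u ->
  cover_data D y q' h' u' ->
  (forall i, cover_weight mu (iter q D y) h u i = cover_weight mu (iter q' D y)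
    h' u' i) ->
  q = q'.
Proof.
wlog qq : q q' h h' u u' / q <= q' => [H cd cd' E|].
  case: (leqP q q') => qq; first exact: (H q q' h h' u u').
  by apply/esym; apply: (H q' q h' h u' u) => //; apply: ltnW.
move=> cd cd' E; case: (ltngtP q q') qq => // qq _.
have := E (iter q D y); rewrite /cover_weight.
have := cover_mu_gt0 noninc mu_k cd (cover_height cd); rewrite addn0.
have lt : iter q D y < iter q' D y.
  by apply: leq_trans (D_gt _) _; apply: (iter_mono D_gt y qq).
have nu a b h1 q1 : cover_data D y q1 h1 a -> (a <= iter b D y < a + h1.-1) = false.
  move=> c; apply/negP => /(cover_above_lt noninc mu_k c)[].
  by have := iter_mono D_gt y (leq0n b); rewrite /=; lia.
rewrite (nu _ q _ _ cd) (nu _ q _ _ cd') leqnn.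
by have := cover_height cd; lia.
Qed.
End CoverUniqueness.

(** * Expansion over the covers marked in a given row *)

Section BounceExpansion.
Variables (k l : nat) (s : seq nat).
Hypothesis s_core : is_core k s.
Hypothesis s_size : (size s <= l)%N.
Local Notation mu := (nth 0%N (pmap_core k s)).
Local Notation D := (row_start k mu).

Definition core_lowered (m d : nat) (t : seq nat) : tseries :=
  lowered l m d (row_start k (nth 0%N (pmap_core k t)))
    (fun i => (nth 0%N (pmap_core k t) i)%:Z).

Definition core_lowered_at (m d : nat) (z : nat) : tseries :=
  lowered l m d D (fun i => (mu i)%:Z - (i == z)%:Z).

Lemma core_lowered_ext m d t (w : nat -> nat) : nth 0%N (pmap_core k t) =1 w ->
  core_lowered m d t = lowered l m d (row_start k w) (fun i => (w i)%:Z).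
Proof. by move=> tw; apply: lowered_eq => i; rewrite /row_start tw. Qed.

Let noninc := core_mu_noninc s_core.
Let mu_k := core_mu_le s_core.
Let D_gt := row_start_gt mu_k.

Lemma core_weight_size i : (l <= i)%N -> mu i = 0%N.
Proof. by move=> li; rewrite nth_default // size_map size_iota; lia. Qed.

Lemma strong_marked_cover_size t r : strong_marked_cover k t r s -> (size t <= l)%N.
Proof.
move=> /andP[/and4P[tC _ /forallP ts _] _]; apply: leq_trans s_size.
have sP : is_partition s by case/andP: s_core.
have tP : is_partition t by case/andP: tC.
rewrite leqNgt; apply/negP => st; have := partition_gt0 (size s) tP.
have := ts (Ordinal (leq_trans st (leq_maxl _ _)));
  rewrite /= (@nth_default _ _ s) //.
by rewrite st; lia.
Qed.

Section Row.
Variables (m : nat).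
Hypothesis m_l : (m < l)%N.
Variables (y q0 : nat).
Hypothesis top : forall a, D a <> y.
Hypothesis q0m : iter q0 D y = m.

(* [t] is the cover of [s] whose lowest component has top row [D^N m]. *)
Definition cover_at (N : nat) (t : seq nat) : Prop :=
  is_core k t /\ exists h u, cover_data D y (q0 + N) h u /\
    forall i, nth 0%N (pmap_core k t) i = cover_weight mu (iter (q0 + N) D y) h u i.

Lemma cover_at_unique N N' t : cover_at N t -> cover_at N' t -> N = N'.
Proof.
move=> [_ [h [u [cd tE]]]] [_ [h' [u' [cd' tE']]]].
apply: (@addnI q0); apply: (cover_weight_bottom s_core cd cd') => i.
by rewrite -tE tE'.
Qed.

Lemma cover_at_eq N t t' : cover_at N t -> cover_at N t' -> t = t'.
Proof.
move=> [tC [h [u [cd tE]]]] [tC' [h' [u' [cd' tE']]]].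
apply: (core_inj tC tC') => i; rewrite tE tE'.
by have [] := cover_data_unique s_core cd cd'.
Qed.

Lemma cover_at_row N t : cover_at N t -> (iter (q0 + N) D y < l)%N.
Proof.
move=> [tC [h [u [cd tE]]]].
have := block_size s_core tC cd tE (leqnn _) (cover_height cd).
by rewrite addn0 => /leq_trans; apply.
Qed.

Lemma cover_atP t : strong_marked_cover k t m.+1 s <-> exists N, cover_at N t.
Proof.
split.
  move=> /andP[/(strong_coverP _ s_core)[y' [q [h [u [tC cd tE]]]]]].
  move=> /(cover_markP s_core tC cd tE)[j jq []] mj.
  have [yy qj] := bounce_top_unique s_core top (cover_top cd) (etrans q0m mj).
  exists (q - j)%N; split=> //; exists h, u; rewrite qj subnKC // yy.
  by split.
move=> [N [tC [h [u [cd tE]]]]]; apply/andP; split.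
  by apply/(strong_coverP _ s_core); exists y, (q0 + N)%N, h, u.
apply/(cover_markP s_core tC cd tE); exists q0; first exact: leq_addr.
by rewrite q0m.
Qed.

(** The exponent from straightening is the spin without its last summand, and that summand is [N]:
    so many components lie below the one marked in row [m]. *)
Lemma cover_at_expand d N : (iter (q0 + N) D y < l)%N ->
  (forall t, cover_at N t -> lowered l m d (bump_row D (iter (q0 + N) D y))
        (fun i => (mu i)%:Z - (i == iter (q0 + N) D y)%:Z) =
     tshift (spin_cover t s m.+1 - N) (core_lowered m d t) /\
     (N <= spin_cover t s m.+1)%N) /\
  ((forall t, ~ cover_at N t) -> lowered l m d (bump_row D (iter (q0 + N) D y))
        (fun i => (mu i)%:Z - (i == iter (q0 + N) D y)%:Z) = 0).
Proof.
move=> zl.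
have mb : exists2 j, (j <= q0 + N)%N & iter j D y = m.
  by exists q0; rewrite ?leq_addr.
have := straightening d noninc mu_k core_weight_size top mb zl.
case=> [[h [u [cd WE]]]|[ncd WE]]; last first.
  split; last by move=> _; exact: WE.
  by move=> t [tC [h [u [cd tE]]]]; case: (ncd h u).
have [t tC tE] := cover_core s_core cd.
have ct : cover_at N t by split=> //; exists h, u.
split; last by move/(_ t).
move=> t' ct'; rewrite -(cover_at_eq ct ct').
have := spin_cover_block s_core tC cd tE (leq_addr N q0); rewrite q0m => ->.
rewrite addKn addnK leq_addl; split; last by [].
by apply: etrans WE _; apply: (congr1 (tshift _)); apply/esym/core_lowered_ext.
Qed.

(** The cover at depth [N] is reached after [N] unrollings of the recurrence, and their factor
    [t ^ N] is the part of the spin that [cover_at_expand] leaves out. *)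
Lemma covers_marked : exists L : seq (seq nat), [/\ uniq L,
  forall t, t \in L <-> strong_marked_cover k t m.+1 s &
  forall d, core_lowered_at m d m =
    \sum_(t <- L) tshift (spin_cover t s m.+1) (core_lowered m d t)].
Proof.
have [c cP] : {c : nat -> seq nat & forall N, (exists t, cover_at N t) ->
  cover_at N (c N)}.
  apply: (@choice _ _ (fun N t => (exists t, cover_at N t) -> cover_at N t)) => N.
  have [[t tN]|nt] := pselect (exists t, cover_at N t); first by exists t.
  by exists [::] => ex; case: nt.
pose r := [seq N <- iota 0 l | `[< exists t, cover_at N t >]].
have rP N : N \in r <-> exists t, cover_at N t.
  rewrite mem_filter mem_iota /=; split; first by move=> /andP[/asboolP].
  move=> ex; rewrite (asboolT ex) /=; have := cover_at_row (cP _ ex).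
  apply: leq_ltn_trans.
  elim: N {ex} => // N IH; rewrite addnS iterS; exact: leq_ltn_trans IH (D_gt _).
have cr N : N \in r -> cover_at N (c N) by move/rP/cP.
exists [seq c N | N <- r]; split.
- rewrite map_inj_in_uniq ?filter_uniq ?iota_uniq // => N N' /cr cN /cr cN' cc.
  by apply: (cover_at_unique cN); rewrite cc.
- move=> t; rewrite cover_atP; split.
    by move=> /mapP[N /cr cN ->]; exists N.
  move=> [N tN]; apply/mapP; exists N; first by apply/rP; exists t.
  by apply: (cover_at_eq tN); apply: cP; exists t.
move=> d; rewrite big_map.
pose V N := if `[< exists t, cover_at N t >] then
  tshift (spin_cover (c N) s m.+1 - N) (core_lowered m d (c N)) else 0.
(* Cut off where the path leaves the first [l] rows. As [D] moves every row down, [F l] is 0 and the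
   unrolling ends. *)
pose F N := if (iter (q0 + N) D y < l)%N then core_lowered_at m d (iter (q0 + N)
  D y) else 0.
have FV N : F N = V N + tshift 1 (F N.+1).
  rewrite /F addnS iterS; case: ltnP => zl; last first.
    have -> : (D (iter (q0 + N) D y) < l)%N = false.
      by apply/negP => H; have := D_gt (iter (q0 + N) D y); lia.
    rewrite tshift0 addr0 /V asboolF // => -[t /cover_at_row]; lia.
  have [W1 W0] := cover_at_expand d zl.
  have VE : V N = lowered l m d (bump_row D (iter (q0 + N) D y))
        (fun i => (mu i)%:Z - (i == iter (q0 + N) D y)%:Z).
    rewrite /V; case: asboolP => [/cP /W1 [-> _] //|nt].
    by rewrite W0 // => t ct; apply: nt; exists t.
  case: ltnP => Dl.
    have := @lowered_recurrence l m d D (fun i =>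
      (mu i)%:Z - (i == iter (q0 + N) D y)%:Z)
      (iter (q0 + N) D y).
    move=> /(_ ltac:(rewrite D_gt Dl //)) E; apply: etrans E _; rewrite VE.
    apply: (congr1 (fun x => _ + tshift 1 x)).
    by apply: lowered_eq => // i; rewrite subrK.
  (* The root to be deleted lies outside the first [l] columns, so its deletion is invisible. *)
  rewrite tshift0 addr0 VE; apply: lowered_ext => // i j /andP[ij jl].
  rewrite /bump_row; case: (i =P iter (q0 + N) D y) => [->|_]; last by rewrite addn0.
  by lia.
have Fn n : F 0%N = \sum_(N <- iota 0 n) tshift N (V N) + tshift n (F n).
  elim: n => [|n IH]; first by rewrite big_nil add0r tshift_0.
  rewrite -[in iota 0 _]addn1 iotaD big_cat big_seq1 add0n.
  apply: etrans IH _; rewrite -addrA; apply: (congr1 (fun x => _ + x)).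
  by rewrite (FV n) tshiftD tshift_tshift addn1.
have F0 : F 0%N = core_lowered_at m d m by rewrite /F addn0 q0m m_l.
have Fl : F l = 0.
  rewrite /F; case: ltnP => H; last by [].
  exfalso.
  have : (l <= iter (q0 + l) D y)%N; last by lia.
  elim: (l) => // N IH; rewrite addnS iterS; exact: leq_ltn_trans IH (D_gt _).
rewrite -F0 (Fn l) Fl tshift0 addr0 [RHS]big_filter [RHS]big_mkcond.
apply: eq_bigr => N _; rewrite /V; case: asboolP => [ex|_]; last exact: tshift0.
have cN := cP _ ex; have [W1 _] := cover_at_expand d (cover_at_row cN).
have [_ le] := W1 _ cN.
by rewrite tshift_tshift subnKC.
Qed.
End Row.
End BounceExpansion.

Lemma lowered_card0 l m D g :
  lowered l m 0 D g = catalanH (row_roots l D) (zvec_of l g).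
Proof.
rewrite /lowered (bigD1 finset.set0) /=; last first.
  by rewrite cards0 eqxx andbT; apply/forall_inP => i; rewrite finset.inE.
rewrite big1 ?addr0; last first.
  by move=> S /andP[/andP[_]]; rewrite cards_eq0 => /eqP ->; rewrite eqxx.
by rewrite /epsS big_set0 subr0.
Qed.

(** * Splitting off the largest lowered row *)

Section Marks.
Variables (l d M : nat).
Hypothesis M_l : (M < l)%N.
Variables (D : nat -> nat) (g : nat -> int).
Let x : 'I_l := Ordinal M_l.
Let F (S : {set 'I_l}) : tseries := catalanH (row_roots l D) (zvec_of l g - epsS S).

Lemma lowered_with_max :
  \sum_(S : {set 'I_l} | [&& [forall i in S, (i < M.+1)%N], #|S| == d.+1 & x \in
    S]) F S
  = lowered l M d D (fun i => g i - (i == M)%:Z).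
Proof.
rewrite (reindex_onto (fun S => x |: S) (fun S => S :\ x)) /=; last first.
  by move=> S /and3P[_ _ xS]; rewrite finset.setD1K.
rewrite /lowered; apply: eq_big => [S|S].
  apply/idP/idP.
    move=> /andP[/and3P[/forall_inP SM /eqP cS _] /eqP Sx].
    have xS : x \notin S by rewrite -Sx !inE eqxx.
    apply/andP; split; last by move: cS; rewrite cardsU1 xS add1n => -[->].
    apply/forall_inP => i iS; have := SM i; rewrite !inE iS orbT => /(_ isT).
    rewrite ltnS leq_eqVlt => /orP[/eqP iM|//]; move: xS.
    by rewrite (_ : x = i) ?iS //; apply: val_inj.
  move=> /andP[/forall_inP SM /eqP cS].
  have xS : x \notin S by apply/negP => /SM; rewrite /= ltnn.
  rewrite cardsU1 xS cS !inE !eqxx /= finset.setU1K // eqxx !andbT.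
  apply/forall_inP => i; rewrite !inE => /orP[/eqP -> //|/SM]; exact: leqW.
move=> /andP[_ /eqP Sx]; have xS : x \notin S by rewrite -Sx !inE eqxx.
rewrite /F; congr catalanH; apply/ffunP => i; rewrite !ffunE !epsSE !inE.
rewrite -val_eqE /= -[in RHS]addrA [in RHS]addrC.
have -> : ((i == x) || (i \in S))%:R = (i == M :> nat)%:Z + (i \in S)%:R :> int.
  case: (i =P x) => [->|ix] /=; first by rewrite (negbTE xS) eqxx addr0.
  have -> : (i == M :> nat) = false by apply/eqP => iM; apply: ix; apply: val_inj.
  by rewrite add0r.
by ring.
Qed.

Lemma lowered_step : lowered l M.+1 d.+1 D g =
  lowered l M d.+1 D g + lowered l M d D (fun i => g i - (i == M)%:Z).
Proof.
rewrite -lowered_with_max [LHS](bigID (fun S : {set 'I_l} => x \notin S)) /=.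
apply: (f_equal2 +%R).
  apply: eq_bigl => S; rewrite andbAC; congr (_ && _); apply/andP/forall_inP.
    move=> [/forall_inP SM xS] i iS; have := SM i iS.
    rewrite ltnS leq_eqVlt => /orP[/eqP iM|//].
    by move: xS; rewrite (_ : x = i) ?iS //; apply: val_inj.
  move=> SM; split; last by apply/negP => /SM; rewrite ltnn.
  by apply/forall_inP => i /SM; apply: leqW.
by apply: eq_bigl => S; rewrite negbK -andbA.
Qed.

Lemma sum_max_marks :
  \sum_(S : {set 'I_l} | (#|S| == d.+1) && (\max_(i in S) i.+1 == M.+1)%N) F S
  = lowered l M d D (fun i => g i - (i == M)%:Z).
Proof.
rewrite -lowered_with_max; apply: eq_bigl => S.
apply/andP/and3P => [[cS /eqP SM]|[/forall_inP SM cS xS]].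
  split=> //.
    apply/forall_inP => i iS; rewrite -SM.
    exact: (@leq_bigmax_cond _ (fun i => i \in S) (fun i : 'I_l => i.+1)).
  have S0 : (0 < #|S|)%N by rewrite (eqP cS).
  have [i iS] := @eq_bigmax_cond _ (mem S) (fun i : 'I_l => i.+1) S0.
  by rewrite SM => -[iM]; rewrite (_ : x = i) //; apply: val_inj.
split=> //; rewrite eqn_leq; apply/andP; split.
  by apply/bigmax_leqP => i /SM.
exact: (@leq_bigmax_cond _ (fun i => i \in S) (fun i : 'I_l => i.+1) x xS).
Qed.
End Marks.

(** * Chains of marked covers *)

Section Chains.
Variables (k l : nat).
Local Notation weight s := (nth 0%N (pmap_core k s)).

Definition chain_to d (s : seq nat) (T : chain d) : Prop :=
  [/\ (forall i, (i <= d)%N -> is_core k (Defs.shape T i)),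
      (forall i, (i < d)%N ->
         strong_marked_cover k (Defs.shape T i) (nth 0%N (marks T) i) (Defs.shape
           T i.+1)),
      sorted ltn (marks T) & Defs.shape T d = s].

Definition chain_rcons d (T : chain d) (s : seq nat) (r : nat) : chain d.+1 :=
  ([tuple of rcons T.1 s], [tuple of rcons T.2 r]).

Lemma shape_rcons d (T : chain d) s r i : (i <= d)%N ->
  Defs.shape (chain_rcons T s r) i = Defs.shape T i.
Proof. by move=> id_; rewrite /Defs.shape /= nth_rcons size_tuple ltnS id_. Qed.

Lemma shape_rcons_last d (T : chain d) s r : Defs.shape (chain_rcons T s r) d.+1 = s.
Proof. by rewrite /Defs.shape /= nth_rcons size_tuple ltnn eqxx. Qed.

Lemma mark_rcons d (T : chain d) s r i : (i < d)%N ->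
  nth 0%N (marks (chain_rcons T s r)) i = nth 0%N (marks T) i.
Proof. by move=> id_; rewrite /marks /= nth_rcons size_tuple id_. Qed.

Lemma mark_rcons_last d (T : chain d) s r :
  nth 0%N (marks (chain_rcons T s r)) d = r.
Proof. by rewrite /marks /= nth_rcons size_tuple ltnn eqxx. Qed.

Lemma spin_rcons d (T : chain d) s r : spin (chain_rcons T s r) =
  (spin_cover (Defs.shape T d) s r + spin T)%N.
Proof.
rewrite /spin big_ord_recr /= addnC shape_rcons // shape_rcons_last mark_rcons_last.
congr (_ + _)%N; apply: eq_bigr => i _.
by rewrite !shape_rcons ?mark_rcons // ltnW.
Qed.

Lemma inside_rcons d (T : chain d) s r : inside k (chain_rcons T s r) = inside k T.
Proof. by rewrite /inside shape_rcons. Qed.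

Lemma chain_rconsP d (T : chain d.+1) : exists T' s r, T = chain_rcons T' s r.
Proof.
have H (A : Type) n (t : n.+1.-tuple A) :
    exists (t' : n.-tuple A) x, t = [tuple of rcons t' x].
  case: t => t tn; case/lastP: t tn => // t x tn.
  have tn' : size t == n by move: tn; rewrite size_rcons eqSS.
  by exists (Tuple tn'), x; apply: val_inj.
case: T => t1 t2; have [t1' [s ->]] := H _ _ t1; have [t2' [r ->]] := H _ _ t2.
by exists (t1', t2'), s, r.
Qed.

Lemma chain_to_rcons d (T : chain d) s s' r : chain_to s (chain_rcons T s' r) <->
  [/\ s' = s, is_core k s, chain_to (Defs.shape T d) T,
      strong_marked_cover k (Defs.shape T d) r s & all (ltn^~ r) (marks T)].
Proof.
have srt : sorted ltn (rcons T.2 r) = all (ltn^~ r) T.2 && sorted ltn T.2.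
  by rewrite !(sorted_pairwise ltn_trans) pairwise_rcons.
split.
  move=> [cores covers]; rewrite /marks /= srt => /andP[ar sT].
  rewrite shape_rcons_last => ss; subst s'.
  have := cores d.+1 (leqnn _); rewrite shape_rcons_last => sC.
  have := covers d (leqnn _);
    rewrite shape_rcons_last shape_rcons // mark_rcons_last => cv.
  split=> //; split=> // i id_.
    by have := cores i (leqW id_); rewrite shape_rcons.
  have := covers i (ltnW id_ : (i < d.+1)%N).
  by rewrite !shape_rcons ?mark_rcons // ltnW.
move=> [-> sC [cores covers sT _] cv ar]; split.
- move=> i; rewrite leq_eqVlt => /orP[/eqP ->|]; first by rewrite shape_rcons_last.
  by rewrite ltnS => id_; rewrite shape_rcons //; apply: cores.
- move=> i; rewrite ltnS leq_eqVlt => /orP[/eqP ->|id_].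
    by rewrite shape_rcons_last shape_rcons // mark_rcons_last.
  by rewrite !shape_rcons ?mark_rcons //; [apply: covers | apply: ltnW].
- by rewrite /marks /= srt ar.
- exact: shape_rcons_last.
Qed.

(** Finiteness of the set of chains is carried along as a duplicate-free list, from which the sum
    over the classical set is recovered at the end. *)
Definition expansion d (P : chain d -> Prop) (f : tseries) : Prop :=
  exists L : seq (chain d), [/\ uniq L, forall T, T \in L <-> P T
    & f = \sum_(T <- L) tshift (spin T) (kschur k (pad l (inside k T)))].

Lemma core_lowered_kschur m (s : seq nat) : is_core k s ->
  core_lowered k l m 0 s = kschur k (pad l (pmap_core k s)).
Proof.
move=> sC; rewrite /core_lowered lowered_card0 /kschur; congr catalanH.
apply/setP => p; rewrite !inE; congr (_ && _); rewrite /row_start ffunE.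
by have := core_mu_le sC p.1; lia.
Qed.

(** The last cover is the one marked [m + 1], supplied by [covers_marked]. What remains of each
    smaller core [t] is lowered in [d] further rows before row [m], and this is expanded into the
    chains ending at [t]. *)
Lemma expansion_last d m (s : seq nat) : is_core k s -> (size s <= l)%N ->
  (m < l)%N ->
  (forall t, is_core k t -> (size t <= l)%N ->
     expansion (fun T : chain d => chain_to t T /\ all (leq^~ m) (marks T))
       (core_lowered k l m d t)) ->
  expansion (fun T : chain d.+1 => chain_to s T /\ nth 0%N (marks T) d = m.+1)
    (core_lowered_at k l s m d m).
Proof.
move=> sC sl ml IH.
have [y [q0 [top q0m]]] := bounce_top sC m.
have [CL [CLu CLP CLE]] := covers_marked sC sl ml top q0m.
have [Lf LfP] : {Lf : seq nat -> seq (chain d) & forall t, is_core k t ->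
  (size t <= l)%N ->
    [/\ uniq (Lf t), forall T, T \in Lf t <-> chain_to t T /\ all (leq^~ m) (marks T)
     & core_lowered k l m d t =
       \sum_(T <- Lf t) tshift (spin T) (kschur k (pad l (inside k T)))]}.
  apply: (@choice _ _ (fun t L => is_core k t -> (size t <= l)%N ->
    [/\ uniq L, forall T, T \in L <-> chain_to t T /\ all (leq^~ m) (marks T)
     & core_lowered k l m d t =
       \sum_(T <- L) tshift (spin T) (kschur k (pad l (inside k T)))])) => t.
  have [[tC tl]|nt] := pselect (is_core k t /\ (size t <= l)%N).
    by have [L HL] := IH t tC tl; exists L.
  by exists [::] => tC tl; case: nt.
have CLC t : t \in CL -> is_core k t /\ (size t <= l)%N.
  by move=> /CLP smc; split;
    [case/andP: smc => /and4P[] | apply: (strong_marked_cover_size sC sl smc)].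
exists [seq chain_rcons T s m.+1 | t <- CL, T <- Lf t]; split.
- apply: allpairs_uniq_dep => //.
    by move=> t /CLC[tC tl]; have [] := LfP t tC tl.
  (* The last shape of the shortened chain recovers [t], so different pairs give different
     chains. *)
  move=> [t T] [t' T'] /allpairsPdep[t0 [T0 [t0C T0L [-> ->]]]].
  move=> /allpairsPdep[t1 [T1 [t1C T1L [-> ->]]]] /= E.
  have TT : T0 = T1.
    case: T0 T1 E {T0L T1L} => [a b] [a' b'] /= [/rcons_inj[/val_inj ->
      ] /rcons_inj[/val_inj ->]] //.
  have [tC tl] := CLC _ t0C; have [tC' tl'] := CLC _ t1C.
  have [_ /(_ T0)[/(_ T0L)[[_ _ _ <-] _] _] _] := LfP _ tC tl.
  have [_ /(_ T1)[/(_ T1L)[[_ _ _ <-] _] _] _] := LfP _ tC' tl'.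
  by rewrite TT.
- move=> T; split.
    move=> /allpairsPdep[t [T' [tC T'L ->]]]; have [tc tl] := CLC _ tC.
    have [_ /(_ T')[/(_ T'L)[cT' aT'] _] _] := LfP _ tc tl.
    split; last exact: mark_rcons_last.
    have sT : Defs.shape T' d = t by case: cT'.
    apply/chain_to_rcons; split=> //; rewrite sT //; exact/CLP.
  move=> [cT mT]; have [T' [s' [r TE]]] := chain_rconsP T.
  move: cT mT; rewrite TE mark_rcons_last => /chain_to_rcons[-> _ cT' smc aT'] rm.
  rewrite rm in smc aT' *; apply/allpairsPdep; exists (Defs.shape T' d), T'.
  have tC : Defs.shape T' d \in CL by apply/CLP.
  split=> //; have [tc tl] := CLC _ tC.
  by have [_ /(_ T')[_ H] _] := LfP _ tc tl; apply: H.
rewrite CLE big_allpairs_dep big_seq [RHS]big_seq; apply: eq_bigr => t tC.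
have [tc tl] := CLC _ tC; have [_ LP ->] := LfP _ tc tl.
rewrite tshift_sum big_seq [RHS]big_seq; apply: eq_bigr => T TL.
have [[_ _ _ sT] _] := (LP T).1 TL.
by rewrite spin_rcons inside_rcons sT tshift_tshift.
Qed.

(** For fixed [d], induction on [m]: either all marks are at most [m], or the last one, being the
    largest, is [m + 1]. [lowered_step] is the same alternative for the subsets. *)
Lemma core_expansion d m (s : seq nat) : is_core k s -> (size s <= l)%N ->
  (m <= l)%N ->
  expansion (fun T : chain d => chain_to s T /\ all (leq^~ m) (marks T))
    (core_lowered k l m d s).
Proof.
elim: d m s => [|d IHd] m s sC sl ml.
  exists [:: ([tuple s], [tuple])]; split=> //.
    move=> T; rewrite inE; split.
      by move=> /eqP ->; split=> //; split=> // -[].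
    case: T => t1 t2 [[_ _ _]]; rewrite (tuple0 t2) /Defs.shape /= => ts _.
    case: (tupleP t1) ts => x t /= ts; rewrite (tuple0 t) ts.
    by apply/eqP; congr pair; apply: val_inj.
  by rewrite big_seq1 /spin big_ord0 tshift_0 core_lowered_kschur.
elim: m ml => [|m IHm] ml.
  (* For [m = 0] both sides are empty: marks are positive, and a nonempty [S] needs a row. *)
  exists [::]; split=> //.
    move=> T; split=> // -[[_ covers _ _]]; have := covers d (leqnn _).
    move=> /andP[_]; case: T {covers} => t1 t2 /=; rewrite /marks /=.
    move=> mk /all_nthP /(_ d); rewrite size_tuple => /(_ 0%N (leqnn _)) /=.
    rewrite leqn0 => /eqP m0; move: mk; rewrite m0.
    by move=> /exists_inP[C _ /andP[/exists_inP[x _ /eqP]]].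
  rewrite big_nil /core_lowered /lowered big1 // => S /andP[/forall_inP S0 /eqP cS].
  have /card_gt0P[i /S0] : (0 < #|S|)%N by rewrite cS.
  by [].
have [L1 [u1 P1 E1]] := IHm (ltnW ml).
have [L2 [u2 P2 E2]] := expansion_last sC sl ml (fun t tC tl =>
  IHd m t tC tl (ltnW ml)).
have last_le (T : chain d.+1) : chain_to s T -> all (leq^~ m.+1) (marks T) <->
    all (leq^~ m) (marks T) \/ nth 0%N (marks T) d = m.+1.
  have [T' [s' [r ->]]] := chain_rconsP T; rewrite mark_rcons_last.
  move=> /chain_to_rcons[_ _ _ _ aT]; rewrite /marks /= !all_rcons; split.
    move=> /andP[]; rewrite leq_eqVlt => /orP[/eqP ->|]; first by right.
    rewrite ltnS => rm _; left; rewrite rm; apply: sub_all aT => x /= xr.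
    by apply: leq_trans rm; apply: ltnW.
  case=> [/andP[rm aT']|rm].
    by rewrite (leqW rm) /=; apply: sub_all aT' => x /=; apply: leqW.
  by rewrite rm leqnn /=; apply: sub_all aT => x /=; rewrite rm; apply: ltnW.
exists (L1 ++ L2); split.
- rewrite cat_uniq u1 u2 andbT /=; apply/hasPn => T /P2[cT mT]; apply/negP => /P1[_].
  move=> /all_nthP /(_ d); rewrite size_tuple => /(_ 0%N (leqnn _)) /=.
  by rewrite mT ltnn.
- move=> T; rewrite mem_cat; split.
    by move=> /orP[/P1[cT aT]|/P2[cT mT]]; split=> //; apply/(last_le _ cT);
      [left | right].
  move=> [cT /(last_le _ cT)[aT|mT]]; apply/orP; [left | right];
    [exact/P1 | exact/P2].
rewrite big_cat; apply: etrans (lowered_step d ml _ _) _.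
by apply: (f_equal2 +%R); [exact: E1 | exact: E2].
Qed.
End Chains.

Theorem theorem9p3 (k l : nat) (hk : (1 <= k)%N) (hl : (1 <= l)%N)
    (lam : zvec l) (hlam : Par k lam) (d m : nat) (hm : (1 <= m <= l)%N) :
  let Phi := Deltak k lam in
  (\sum_(S : {set 'I_l} | [forall i in S, (i.+1 <= m)%N] && (#|S| == d))
      catalanH Phi (lam - epsS S)
   = \sum_(T \in [set T : chain d |
                    VSMT k d lam T /\ all (fun r => r <= m)%N (marks T)]%classic)
      tshift (spin T) (kschur k (pad l (inside k T))))
  /\
  (\sum_(S : {set 'I_l} | (#|S| == d) && (\max_(i in S) i.+1 == m)%N)
      catalanH Phi (lam - epsS S)
   = \sum_(T \in [set T : chain d |
                    VSMT k d lam T /\ (\max_(r <- marks T) r = m)%N]%classic)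
      tshift (spin T) (kschur k (pad l (inside k T)))).
Proof.
move=> Phi.
have [lamk lamle] := hlam.
(* Extended by zero beyond row [l], so that bounce paths may run on without a boundary case. *)
pose mu i : nat := if insub i is Some j then absz (lam j) else 0%N.
have muE (i : 'I_l) : (mu i)%:Z = lam i.
  by rewrite /mu valK; have /andP[] := lamk i; lia.
have mu0 i : (l <= i)%N -> mu i = 0%N by move=> li; rewrite /mu insubF // ltnNge li.
have muk i : (mu i <= k)%N.
  case: (ltnP i l) => il; last by rewrite mu0.
  by have := muE (Ordinal il); have /andP[] := lamk (Ordinal il); rewrite /=; lia.
have mule i : (mu i.+1 <= mu i)%N.
  case: (ltnP i.+1 l) => il; last by rewrite mu0.
  have := lamle (Ordinal (ltnW il)) (Ordinal il) (leqnSn i).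
  by rewrite -!muE.
have [s [sC sE]] := core_exists mule muk mu0.
have sl : (size s <= l)%N.
  rewrite leqNgt -(core_mu_size sC) sE mu0 //.
have sumE (S : {set 'I_l}) : catalanH Phi (lam - epsS S) =
    catalanH (row_roots l (row_start k mu)) (zvec_of l (fun i =>
      (mu i)%:Z) - epsS S).
  congr (catalanH _ (_ - _)).
    apply/setP => p; rewrite !inE; congr (_ && _); rewrite /row_start -!muE.
    by have := muk p.1; lia.
  by apply/ffunP => i; rewrite ffunE muE.
have chainE d0 (T : chain d0) : VSMT k d0 lam T <-> chain_to k s T.
  have key t : is_core k t -> same_partition (pmap_core k t) lam <-> t = s.
    move=> tC; split.
      move=> /andP[/all_nthP zt /eqP tlam]; apply: (core_inj tC sC) => i.
      case: (ltnP i l) => il.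
        have := muE (Ordinal il); rewrite -tlam ffunE /= sE; lia.
      rewrite sE mu0 // -(subnKC il) -nth_drop.
      case: (ltnP (i - l) (size (drop l (pmap_core k t)))) => H.
        exact/eqP/(zt 0%N).
      by rewrite nth_default.
    move=> ->; apply/andP; split; last by apply/eqP/ffunP => i; rewrite ffunE sE muE.
    by rewrite drop_oversize // size_map size_iota.
  split; move=> [c1 c2 c3 c4]; split=> //; apply/(key _ (c1 d0 (leqnn _))) => //.
split.
  have [L [uL LP LE]] := core_expansion d sC sl (andP hm).2.
  have -> : [set T : chain d | VSMT k d lam T /\ all (fun r =>
    r <= m)%N (marks T)]%classic
      = [set` L]%classic.
    apply/seteqP; split=> T /=.
      by move=> [/chainE cT aT]; apply/LP.
    by move=> /LP[/chainE cT aT].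
  apply: etrans _ (fsbig_seq _ _ uL); apply: etrans _ LE.
  apply: etrans _ (esym (core_lowered_ext l m d sE)).
  by apply: eq_bigr => S _; apply: sumE.
case: m hm => // m hm.
(* For [d = 0] the maximum over an empty set of marks is 0, not [m.+1], so both sums are empty. *)
case: d => [|d].
  rewrite big_pred0; last first.
    by move=> S; apply/negP => /andP[]; rewrite cards_eq0 => /eqP ->;
      rewrite big_set0.
  rewrite (_ : [set T | _]%classic = classical_sets.set0) ?fsbig_set0 //.
  apply/seteqP; split=> // T [_]; case: T => t1 t2; rewrite (tuple0 t2).
  by rewrite /marks /= big_nil.
have ml : (m < l)%N by case/andP: hm.
have [L [uL LP LE]] := expansion_last sC sl ml
  (fun t tC tl => core_expansion d tC tl (ltnW ml)).
have -> : [set T : chain d.+1 | VSMT k d.+1 lam T /\ (\max_(r <- marks T) r =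
  m.+1)%N]%classic
    = [set` L]%classic.
  have maxE (T : chain d.+1) : chain_to k s T ->
    (\max_(r <- marks T) r = nth 0 (marks T) d)%N.
    have [T' [s' [r ->]]] := chain_rconsP T; rewrite mark_rcons_last.
    move=> /chain_to_rcons[_ _ _ _ aT]; rewrite /marks /= big_rcons /=.
    apply/maxn_idPr; apply/bigmax_leqP_seq => x xT _.
    by apply: ltnW; exact: (allP aT).
  apply/seteqP; split=> T /=.
    by move=> [/chainE cT aT]; apply/LP; split=> //; rewrite -maxE.
  by move=> /LP[cT aT]; split; [apply/chainE | rewrite maxE].
apply: etrans _ (fsbig_seq _ _ uL); apply: etrans _ LE.
apply: etrans (eq_bigr _ (fun S _ => sumE S)) _.
apply: etrans (sum_max_marks d ml _ _) _.
by apply: lowered_eq => i; rewrite /row_start sE.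
Qed.
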